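(* Let $B=2^{k_1}C_1\perp\cdots\perp2^{k_r}C_r\in\mathcal H_n(\mathfrak o)$ be a pre-optimal form and $n_r=\deg C_r$. Then there is an optimal basis $\{\phi_1,\ldots,\phi_n\}$ of $L_B$ such that $\{\phi_1,\ldots,\phi_{n-n_r}\}$ is an optimal basis of $L_{B^{[r-1]}}$.
   Context: Let $F$ be a finite unramified extension of $\mathbb Q_2$ with ring of integers $\mathfrak o$, $\mathrm{ord}$ the valuation with $\mathrm{ord}(2)=1$, $\mathrm{ord}(0)=+\infty$. $\mathcal H_n(\mathfrak o)$ is the set of symmetric $B=(b_{ij})\in M_n(F)$ with $b_{ii}\in\mathfrak o$, $2b_{ij}\in\mathfrak o$. $\perp$ is block-diagonal sum. For nondegenerate $B$ of degree $n$: $D_B=(-4)^{[n/2]}\det B$; $\xi_B=1,-1,0$ according as $D_B\in F^{\times2}$, $F(\sqrt{D_B})/F$ unramified quadratic, or ramified. $S_2(\mathfrak o)_e$: symmetric $2\times2$ matrices over $\mathfrak o$ with diagonal in $2\mathfrak o$; unimodular diagonal: diagonal with unit entries. GK invariant: $S(B)$ = set of non-decreasing $(a_i)\in\mathbb Z_{\ge0}^n$ with $\mathrm{ord}(b_{ii})\ge a_i$, $\mathrm{ord}(2b_{ij})\ge(a_i+a_j)/2$ ($1\le i\le j\le n$); $\mathrm{GK}(B)$ = lexicographically greatest element of $\bigcup_{U\in GL_n(\mathfrak o)}S({}^tUBU)$; $B$ optimal if $\mathrm{GK}(B)\in S(B)$. Quadratic modules: for $B\in\mathcal H_n(\mathfrak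 o)$, $L_B$ is a free $\mathfrak o$-module with basis $\psi_1,\dots,\psi_n$ and quadratic form $Q$ whose bilinear form $(x,y)=Q(x+y)-Q(x)-Q(y)$ satisfies $\frac12(\psi_i,\psi_j)=b_{ij}$. A basis $u_1,\dots,u_n$ is optimal if $(\frac12(u_i,u_j))$ is optimal. For $B=B_1\perp B_2$ with $\deg B_1=n_1$, $L_{B_1}$ is the submodule spanned by $\psi_1,\dots,\psi_{n_1}$. Pre-optimal forms: $B=2^{k_1}C_1\perp\cdots\perp2^{k_r}C_r$ with $k_i\ge0$, each $C_i$ unimodular diagonal or in $\frac12(S_2(\mathfrak o)_e\cap GL_2(\mathfrak o))$; $B^{[j]}=2^{k_1}C_1\perp\cdots\perp2^{k_j}C_j$; $\mathcal D_m=\{j:k_j=m,C_j\text{ diagonal}\}$, $\mathcal E_m=\{j:k_j=m,C_j\text{ not diagonal}\}$. Pre-optimal means: (PO1) $\sum_{j\in\mathcal D_m}\deg C_j\le2$ and $\mathcal E_m$ is a (possibly empty) set of consecutive integers, for each $m$; (PO2) for $i<j$: $i\in\mathcal D_{m_1},j\in\mathcal D_{m_2}\Rightarrow m_1\le m_2$; $i\in\mathcal E_{m_1},j\in\mathcal E_{m_2}\Rightarrow m_1\le m_2$; $i\in\mathcal D_{m_1},j\in\mathcal E_{m_2}\Rightarrow m_1\le m_2-1$; $i\in\mathcal E_{m_1},j\in\mathcal D_{m_2}\Rightarrow m_1\le m_2+1$; (PO3) if $C_i$ is unimodular diagonal of degree 2 then $i\ge2$ and either ($\deg B^{[i]}$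 even and $\xi_{B^{[i-1]}}=\xi_{B^{[i]}}=0$) or ($\deg B^{[i-1]}$ odd and $\mathrm{ord}\det B^{[i-1]}+k_i$ even); (PO4) if $k_i=k_{i-1}-1$, $C_i$ diagonal, $C_{i-1}$ not diagonal, then $\deg C_i=2$, or $\deg C_i=1$ and either ($\deg B^{[i]}$ and $\mathrm{ord}\det B^{[i]}$ even) or ($\deg B^{[i]}$ odd and $\xi_{B^{[i-1]}}=0$); (PO5) if $C_i$ diagonal, $C_{i+1}$ not diagonal, $k_i=k_{i+1}-1$, then $\deg C_i=1$ and either ($\deg B^{[i]}$ even and $\mathrm{ord}\det B^{[i]}$ odd) or ($\deg B^{[i]}$ odd and $\xi_{B^{[i-1]}}\ne0$ if $i\ge2$); (PO6) if $\deg B^{[i]}$ even, $C_i,C_{i+1}$ unimodular diagonal, $k_{i+1}=k_i+1$, then $\xi_{B^{[i]}}=0$. *)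

(* Defs.v *)
From HB Require Import structures.
From mathcomp Require Import all_boot all_order all_algebra.
Set Implicit Arguments. Unset Strict Implicit. Unset Printing Implicit Defensive.
Import Order.TTheory GRing.Theory Num.Theory.
Local Open Scope ring_scope.

Section Defs.
Variables (F : fieldType) (v : F -> int).
(* v is the valuation ord on F^x (v 0 is irrelevant junk; ord(0) = +oo is
   handled by the predicates below). *)

(* ord x >= k, with the convention ord 0 = +oo *)
Definition ord_ge (x : F) (k : int) : Prop := x = 0 \/ k <= v x.
Definition in_o (x : F) : Prop := ord_ge x 0.
Definition unit_o (x : F) : Prop := x != 0 /\ v x = 0.

Definition residue_finite : Prop :=
  exists s : seq F, (forall y, y \in s -> in_o y) /\
    forall x, in_o x -> exists2 y, y \in s & ord_ge (x - y) 1.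

Definition v_complete : Prop :=
  forall u : nat -> F,
    (forall N : int, exists M, forall p q, (M <= p)%N -> (M <= q)%N -> ord_ge (u p - u q) N) ->
    exists l, forall N : int, exists M, forall p, (M <= p)%N -> ord_ge (u p - l) N.

(* (F, v) is a finite unramified extension of Q_2 with its normalized valuation:
   a complete discretely valued field of characteristic 0 in which 2 is a
   uniformizer (ord 2 = 1) and with finite residue field. *)
Record unram2adic : Prop := {
  u2_char0 : [pchar F] =i pred0;
  u2_mul : forall x y, x != 0 -> y != 0 -> v (x * y) = v x + v y;
  u2_add : forall x y, x != 0 -> y != 0 -> x + y != 0 -> Num.min (v x) (v y) <= v (x + y);
  u2_two : v 2 = 1;
  u2_res : residue_finite;
  u2_complete : v_complete }.

Definition in_Hn n (B : 'M[F]_n) : Prop :=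
  B^T = B /\ (forall i, in_o (B i i)) /\ (forall i j, in_o (2 * B i j)).

Definition in_GLo n (U : 'M[F]_n) : Prop :=
  (forall i j, in_o (U i j)) /\ unit_o (\det U).

Definition in_S n (B : 'M[F]_n) (a : 'I_n -> nat) : Prop :=
  (forall i j : 'I_n, (i <= j)%N -> (a i <= a j)%N) /\
  (forall i : 'I_n, ord_ge (B i i) (a i)%:Z) /\
  (forall i j : 'I_n, (i <= j)%N ->
      2 * B i j = 0 \/ ((a i + a j)%N%:Z <= 2 * v (2 * B i j))).

Definition lex_le n (a b : 'I_n -> nat) : Prop :=
  a =1 b \/ exists i : 'I_n, (a i < b i)%N /\ forall j : 'I_n, (j < i)%N -> a j = b j.

Definition is_GK n (B : 'M[F]_n) (a : 'I_n -> nat) : Prop :=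
  (exists U, in_GLo U /\ in_S (U^T *m B *m U) a) /\
  forall U a', in_GLo U -> in_S (U^T *m B *m U) a' -> lex_le a' a.

Definition optimal n (B : 'M[F]_n) : Prop := exists a, is_GK B a /\ in_S B a.

Definition is_sq (x : F) : Prop := exists y, x = y ^+ 2.

(* F(sqrt D)/F is an unramified quadratic extension: D is not a square and the
   (unique) extension of ord to F(sqrt D), x |-> ord(N x)/2, has value group Z,
   i.e. norms a^2 - D b^2 of nonzero elements have even valuation. *)
Definition unram_quad (D : F) : Prop :=
  ~ is_sq D /\ forall a b : F, (a != 0 \/ b != 0) -> ~~ odd `|v (a ^+ 2 - D * b ^+ 2)|%N.

Definition xi_val (D : F) (e : int) : Prop :=
  (e = 1 /\ D != 0 /\ is_sq D) \/
  (e = -1 /\ D != 0 /\ unram_quad D) \/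
  (e = 0 /\ D != 0 /\ ~ is_sq D /\ ~ unram_quad D).

Definition DB n (B : 'M[F]_n) : F := (-4) ^+ (n./2) * \det B.

(* BDiag k us : 2^k * diag(us);  BNon k a b c : 2^k * (1/2) [[2a, b],[b, 2c]] *)
Inductive blk := BDiag of nat & seq F | BNon of nat & F & F & F.

Definition blk_k (b : blk) : nat := match b with BDiag k _ => k | BNon k _ _ _ => k end.
Definition blk_deg (b : blk) : nat := match b with BDiag _ us => size us | BNon _ _ _ _ => 2 end.
Definition blk_isdiag (b : blk) : bool := if b is BDiag _ _ then true else false.

Definition blk_wf (b : blk) : Prop :=
  match b with
  | BDiag _ us => (0 < size us)%N /\ forall x, x \in us -> unit_o x
  | BNon _ a b c => in_o a /\ in_o b /\ in_o c /\ unit_o (4 * a * c - b ^+ 2)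
  end.

Definition blk_entry (b : blk) (i j : nat) : F :=
  match b with
  | BDiag k us => if i == j then 2 ^+ k * nth 0 us i else 0
  | BNon k a b c =>
      2 ^+ k * (if (i == 0%N) && (j == 0%N) then a
                else if (i == 1%N) && (j == 1%N) then c else b / 2)
  end.

Fixpoint bmat (bs : seq blk) (i j : nat) : F :=
  match bs with
  | [::] => 0
  | b :: bs' =>
      let d := blk_deg b in
      if (i < d)%N && (j < d)%N then blk_entry b i j
      else if (d <= i)%N && (d <= j)%N then bmat bs' (i - d) (j - d) else 0
  end.

Definition totdeg (bs : seq blk) : nat := sumn (map blk_deg bs).

Definition mxn n (f : nat -> nat -> F) : 'M[F]_n := \matrix_(i < n, j < n) f i j.

Definition Bof (bs : seq blk) : 'M[F]_(totdeg bs) := mxn (totdeg bs) (bmat bs).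

Section PO.
Variable bs : seq blk.
(* 1-indexed access to blocks and to B^[j] *)
Let r := size bs.
Let bk (i : nat) := nth (BDiag 0 [::]) bs i.-1.
Let kk i := blk_k (bk i).
Let isD i := blk_isdiag (bk i).
Let dg i := blk_deg (bk i).
Let degpre j := totdeg (take j bs).
Let detpre j := \det (Bof (take j bs)).
Let xi j (e : int) := xi_val (DB (Bof (take j bs))) e.

Definition PO1 : Prop :=
  (forall m, (\sum_(b <- bs | blk_isdiag b && (blk_k b == m)) blk_deg b <= 2)%N) /\
  (forall m i j l, (1 <= i)%N -> (i < l)%N -> (l < j)%N -> (j <= r)%N ->
     ~~ isD i -> kk i = m -> ~~ isD j -> kk j = m -> ~~ isD l /\ kk l = m).

Definition PO2 : Prop :=
  forall i j, (1 <= i)%N -> (i < j)%N -> (j <= r)%N ->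
    [/\ (isD i -> isD j -> kk i <= kk j)%N,
        (~~ isD i -> ~~ isD j -> kk i <= kk j)%N,
        (isD i -> ~~ isD j -> kk i <= (kk j).-1 /\ 1 <= kk j)%N &
        (~~ isD i -> isD j -> kk i <= kk j + 1)%N].

Definition PO3 : Prop :=
  forall i, (1 <= i)%N -> (i <= r)%N -> isD i -> dg i = 2%N ->
    (2 <= i)%N /\
    ((~~ odd (degpre i) /\ xi i.-1 0 /\ xi i 0) \/
     (odd (degpre i.-1) /\ ~~ odd `|(v (detpre i.-1) + (kk i)%:Z)%R|%N)).

Definition PO4 : Prop :=
  forall i, (2 <= i)%N -> (i <= r)%N -> (kk i + 1 = kk i.-1)%N -> isD i -> ~~ isD i.-1 ->
    dg i = 2%N \/
    (dg i = 1%N /\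
     ((~~ odd (degpre i) /\ ~~ odd `|v (detpre i)|%N) \/
      (odd (degpre i) /\ xi i.-1 0))).

Definition PO5 : Prop :=
  forall i, (1 <= i)%N -> (i < r)%N -> isD i -> ~~ isD i.+1 -> (kk i + 1 = kk i.+1)%N ->
    dg i = 1%N /\
    ((~~ odd (degpre i) /\ odd `|v (detpre i)|%N) \/
     (odd (degpre i) /\ ((2 <= i)%N -> ~ xi i.-1 0))).

Definition PO6 : Prop :=
  forall i, (1 <= i)%N -> (i < r)%N -> ~~ odd (degpre i) -> isD i -> isD i.+1 ->
    (kk i.+1 = kk i + 1)%N -> xi i 0.

Definition preoptimal : Prop :=
  (forall i, (i < size bs)%N -> blk_wf (nth (BDiag 0 [::]) bs i)) /\ PO1 /\ PO2 /\ PO3 /\ PO4 /\ PO5 /\ PO6.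
End PO.

End Defs.

(* Main.v *)
Require Import Defs.
From HB Require Import structures.
From mathcomp Require Import all_boot all_order all_fingroup all_algebra zify ring.
From Stdlib Require Import Classical.
Set Implicit Arguments. Unset Strict Implicit. Unset Printing Implicit Defensive.
Import Order.TTheory GRing.Theory Num.Theory.
Local Open Scope ring_scope.

(** The Gram matrix is [A = 2B] and [D = (-1)^[n/2] det A].  Weights [a] in [S(B)]
    form a norm dominated by the quadratic form; splitting off planes on which
    the domination is sharp shows [|a| <= Delta(B)], where [Delta] depends only
    on [ord D] and on whether [D] is a square modulo 4, that is, on [xi].
    Equality also produces "open" vectors: nearly orthogonal to the lattice, with
    [Q] taking exactly the value given by the norm, and realising both parities
    when [n] is even and [xi = 0].

    Weights with [|a| = Delta] on every leading block where they jump are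
    [GK(B)]: if [a'] were larger, first at [i], put [m = a_i + 1] and let [p] count
    the weights [< m].  Adjoining vectors dual to the last [n - p] basis vectors up
    to the factor [2^m] leaves only the determinant of the leading block of size
    [p], and the inequality for the weights [min(a', m)] fails there.

    A pre-optimal form is then treated block by block.  A non-diagonal block
    [2^k C] is appended with weights [(k, k)].  A diagonal vector [y] of level [k] is
    corrected by open vectors of levels [k] and [k+1], which raises its weight to
    [k], [k+1] or [k+2], as dictated by [Delta].  The conditions (PO1)-(PO6) say
    that the weights obtained in this way are non-decreasing, except for two
    successive blocks of degree 1 with the same [k] whose weights would be [k+2]
    and [k]; correcting both vectors from the lattice before them gives
    [(k+1, k+1)], and the first one alone still has weight [k+2]. *)

(** * Valuations *)

Section Valuation.
Variables (F : fieldType) (v : F -> int).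
Hypothesis Hv : unram2adic v.

(* [2 ord x >= k]: doubling keeps the half-integral bounds [(a_i + a_j)/2] in [int] *)
Definition hv (x : F) (k : int) : Prop := x = 0 \/ k <= 2 * v x.

Lemma two_neq0 : (2 : F) != 0.
Proof.
have := u2_char0 Hv 2%N; rewrite !inE /= => h; apply/negP => /eqP h2.
by move: h; rewrite h2 eqxx.
Qed.

Lemma v1 : v 1 = 0.
Proof. have := u2_mul Hv (oner_neq0 F) (oner_neq0 F); rewrite mulr1; set z := v _; lia. Qed.

Lemma vM x y : x != 0 -> y != 0 -> v (x * y) = v x + v y.
Proof. exact: (u2_mul Hv). Qed.

Lemma vN x : v (- x) = v x.
Proof.
have n1 : (-1 : F) != 0 by rewrite oppr_eq0 oner_eq0.
have h : v (-1) = 0 by have := vM n1 n1; rewrite mulrNN mulr1 v1; lia.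
have [->|x0] := eqVneq x 0; first by rewrite oppr0.
by rewrite -mulN1r vM // h add0r.
Qed.

Lemma vV x : x != 0 -> v x^-1 = - v x.
Proof.
move=> x0; have x0' : x^-1 != 0 by rewrite invr_eq0.
have := vM x0 x0'; rewrite divff // v1; lia.
Qed.

Lemma vX x n : x != 0 -> v (x ^+ n) = n%:Z * v x.
Proof.
move=> x0; elim: n => [|n IH]; first by rewrite expr0 v1 mul0r.
rewrite exprS vM ?expf_neq0 // IH; lia.
Qed.

Lemma v_pow2 n : v (2 ^+ n) = n%:Z.
Proof. by rewrite vX ?two_neq0 // (u2_two Hv) mulr1. Qed.

Lemma vXz x (n : int) : x != 0 -> v (x ^ n) = n * v x.
Proof.
move=> x0; case: n => n; first exact: vX.
rewrite NegzE -exprnN vV ?expf_neq0 // vX //; lia.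
Qed.

Lemma v_pow2z (n : int) : v (2 ^ n) = n.
Proof. by rewrite vXz ?two_neq0 // (u2_two Hv) mulr1. Qed.

Lemma pow2_neq0 n : (2 : F) ^+ n != 0.
Proof. by rewrite expf_neq0 ?two_neq0. Qed.

Lemma pow2z_neq0 (n : int) : (2 : F) ^ n != 0.
Proof. by rewrite expfz_neq0 ?two_neq0. Qed.

Lemma hvW x k l : hv x l -> k <= l -> hv x k.
Proof. by case=> [->|h] h'; [left|right; lia]. Qed.

Lemma hvE x k : x != 0 -> hv x k -> k <= 2 * v x.
Proof. by move=> x0 [/eqP|//]; rewrite (negPf x0). Qed.

Lemma hvv x : hv x (2 * v x).
Proof. by right. Qed.

(* valuations are integers, so an odd doubled bound improves by one *)
Lemma hv_round x k : hv x (2 * k - 1) -> hv x (2 * k).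
Proof. by case=> [->|h]; [left|right; lia]. Qed.

Lemma hvN x k : hv x k -> hv (- x) k.
Proof. by case=> [->|h]; [left; rewrite oppr0|right; rewrite vN]. Qed.

Lemma hvD x y k : hv x k -> hv y k -> hv (x + y) k.
Proof.
case=> [->|hx]; first by rewrite add0r.
case=> [->|hy]; first by rewrite addr0; right.
have [->|x0] := eqVneq x 0; first by rewrite add0r; right.
have [->|y0] := eqVneq y 0; first by rewrite addr0; right.
have [->|xy0] := eqVneq (x + y) 0; first by left.
right; have := u2_add Hv x0 y0 xy0.
by set z := v (x + y); set a := v x; set b := v y; rewrite ge_min => /orP []; lia.
Qed.

Lemma hvB x y k : hv x k -> hv y k -> hv (x - y) k.
Proof. by move=> hx hy; apply: hvD => //; apply: hvN. Qed.

Lemma hvM x y k l : hv x k -> hv y l -> hv (x * y) (k + l).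
Proof.
move=> hx hy.
have [->|x0] := eqVneq x 0; first by rewrite mul0r; left.
have [->|y0] := eqVneq y 0; first by rewrite mulr0; left.
by right; rewrite vM //; have := hvE x0 hx; have := hvE y0 hy; lia.
Qed.

Lemma hv_div x y k : y != 0 -> hv x k -> hv (x / y) (k - 2 * v y).
Proof. by move=> y0 hx; apply: hvM => //; right; rewrite vV //; lia. Qed.

Lemma hv_sum (I : Type) (r : seq I) (P : pred I) (E : I -> F) k :
  (forall i, P i -> hv (E i) k) -> hv (\sum_(i <- r | P i) E i) k.
Proof. by move=> h; elim/big_ind: _ => //; [left|move=> x y; apply: hvD]. Qed.

Lemma hv_prod (I : Type) (r : seq I) (P : pred I) (E : I -> F) (k : I -> int) :
  (forall i, P i -> hv (E i) (k i)) ->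
  hv (\prod_(i <- r | P i) E i) (\sum_(i <- r | P i) k i).
Proof.
move=> h; elim/big_rec2: _ => [|i y1 y2 Pi IH]; first by right; rewrite v1.
exact: hvM (h i Pi) IH.
Qed.

Lemma hvX x k n : hv x k -> hv (x ^+ n) (n%:Z * k).
Proof.
move=> h; elim: n => [|n IH]; first by right; rewrite v1 mul0r.
by rewrite exprS; apply: hvW (hvM h IH) _; lia.
Qed.

Lemma hv_o x : in_o v x <-> hv x 0.
Proof. by split; case=> [->|h]; [left|right; lia|left|right; lia]. Qed.

Lemma hv_ge x k : ord_ge v x k <-> hv x (2 * k).
Proof. by split; case=> [->|h]; [left|right; lia|left|right; lia]. Qed.

(** Isosceles principle: a doubled bound exceeding [2 * v x] by 1 already means [v y > v x], so [x]
    dominates the sum. *)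
Lemma hv_addE x y : x != 0 -> hv y (2 * v x + 1) -> x + y != 0 /\ v (x + y) = v x.
Proof.
move=> x0 hy.
have xy0 : x + y != 0.
  apply/negP => /eqP h; have e : y = - x by rewrite -[y](addKr x) h addr0.
  by move: hy; rewrite e => /hvE; rewrite oppr_eq0 vN => /(_ x0); lia.
split=> //.
have h1 : hv (x + y) (2 * v x) by apply: hvD (hvv _) (hvW hy _); lia.
have h2 := hvE xy0 h1.
case: (ltrP (v x) (v (x + y))) => h3; last by lia.
have h4 : hv (x + y) (2 * v x + 1) by right; lia.
have := hvB h4 hy; rewrite addrK => /(hvE x0); lia.
Qed.

Lemma hv_eqv x y : x != 0 -> hv (x - y) (2 * v x + 1) -> y != 0 /\ v y = v x.
Proof.
move=> x0 h; have := hv_addE x0 (hvN h); by rewrite opprB addrC subrK.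
Qed.

(* The sequence [u, u^2, u^4, ...] repeats modulo 2, and squaring is injective
   modulo 2, so [u] itself is congruent to a later, hence square, term. *)
Lemma residue_perfect u : unit_o v u -> exists2 s, unit_o v s & hv (u - s ^+ 2) 2.
Proof.
move=> [u0 vu].
have hu n : hv (u ^+ n) 0 by right; rewrite vX // vu; lia.
have [l [hl1 hl2]] := u2_res Hv.
have sqinj x y : hv x 0 -> hv y 0 -> hv (x ^+ 2 - y ^+ 2) 2 -> hv (x - y) 2.
  move=> hx hy h.
  have h2 : hv ((x - y) ^+ 2) 2.
    have -> : (x - y) ^+ 2 = (x ^+ 2 - y ^+ 2) - 2 * (y * (x - y)) by ring.
    apply: hvB => //; apply: hvW (hvM (hvv 2) (hvM hy (hvB hx hy))) _.
    by rewrite (u2_two Hv).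
  have [->|z0] := eqVneq (x - y) 0; first by left.
  by right; have := hvE (expf_neq0 2 z0) h2; rewrite vX //; lia.
pose w n := u ^+ (2 ^ n).
have wint n : w n.+1 = w n ^+ 2 by rewrite /w expnS mulnC exprM.
have [f hf] : exists f : nat -> nat, forall n, (f n < size l)%N /\ hv (w n - nth 0 l (f n)) 2.
  have h n : exists i, (i < size l)%N /\ hv (w n - nth 0 l i) 2.
    have /hl2 [y yl /hv_ge hy] : in_o v (w n) by apply/hv_o; apply: hu.
    by exists (index y l); rewrite index_mem yl nth_index.
  have h' n : exists i, (i < size l)%N && ((w n - nth 0 l i == 0) || (2 <= 2 * v (w n - nth 0 l i))).
    have [i [i1 i2]] := h n; exists i; rewrite i1 /=.
    by case: i2 => [->|->]; rewrite ?eqxx ?orbT.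
  exists (fun n => xchoose (h' n)) => n.
  have := xchooseP (h' n) => /andP [-> h2]; split=> //.
  by case/orP: h2 => [/eqP ->|h2]; [left|right].
pose g (i : 'I_(size l).+1) : 'I_(size l) := Ordinal (hf i).1.
have [i [j [ij gij]]] : exists i j : 'I_(size l).+1, (i < j)%N /\ g i = g j.
  have : ~~ injectiveb g.
    apply/negP => /injectiveP gi; have := leq_card g gi.
    by rewrite !card_ord ltnn.
  move/injectivePn => [x [y xy e]].
  case: (ltngtP x y) => h; [by exists x, y|by exists y, x|].
  by move: xy; rewrite (val_inj h) eqxx.
have hij : hv (w i - w j) 2.
  have /(congr1 val) /= e := gij.
  have h1 := (hf i).2; have h2 := (hf j).2; rewrite -e in h2.
  by have := hvB h1 h2; rewrite opprB addrA subrK.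
have down n m : hv (w n - w (n + m)%N) 2 -> hv (w 0%N - w m) 2.
  elim: n => [//|n IH] h; apply: IH; apply: sqinj; try exact: hu.
  by rewrite -!wint -addSn.
have := down i (j - i)%N; rewrite subnKC ?(ltnW ij) // => /(_ hij).
have -> : (j - i)%N = (j - i).-1.+1 by lia.
rewrite wint {1}/w expn0 expr1 => h.
exists (w (j - i).-1) => //; split; first by rewrite expf_neq0.
by rewrite vX // vu mulr0.
Qed.

(** * Squares modulo 4 and the value of xi *)

(* for [D != 0]: the extension [F(sqrt D)/F] is trivial or unramified quadratic *)
Definition Sq4 (D : F) : Prop := exists P, hv (D - P ^+ 2) (2 * v D + 4).

Definition evz (x : int) : Prop := exists h, x = 2 * h.
Definition odz (x : int) : Prop := exists h, x = 2 * h + 1.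

Lemma evz_or_odz x : evz x \/ odz x.
Proof.
have [h|h] : (2 %| x)%Z \/ ~ (2 %| x)%Z by case: (2 %| x)%Z; [left|right].
  by left; exists (x %/ 2)%Z; lia.
by right; exists (x %/ 2)%Z; lia.
Qed.

Lemma evz_odzF x : evz x -> odz x -> False.
Proof. by move=> [h ->] [g e]; lia. Qed.

Lemma odd_absz (x : int) : odd `|x|%N <-> odz x.
Proof.
split=> [h|[h e]]; first by exists (x %/ 2)%Z; lia.
have : ~~ (2 %| x)%Z by lia.
by lia.
Qed.

Lemma Nodd_absz (x : int) : ~~ odd `|x|%N <-> evz x.
Proof.
split=> [h|[h e]]; first by exists (x %/ 2)%Z; lia.
have : (2 %| x)%Z by lia.
by lia.
Qed.

(** The error has larger order than [D], so [P ^+ 2] and [D] have the same order, which is therefore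
    even. *)
Lemma Sq4_root D : D != 0 -> Sq4 D ->
  exists P, [/\ P != 0, v D = 2 * v P & hv (D - P ^+ 2) (2 * v D + 4)].
Proof.
move=> D0 [P hP]; exists P.
have [P0 vP] : P ^+ 2 != 0 /\ v (P ^+ 2) = v D by apply: hv_eqv => //; apply: hvW hP _; lia.
have P0' : P != 0 by apply: contraNneq P0 => ->; rewrite expr0n.
by split=> //; rewrite -vP vX.
Qed.

Lemma Sq4_evz D : D != 0 -> Sq4 D -> evz (v D).
Proof. by move=> D0 /(Sq4_root D0) [P [_ -> _]]; exists (v P). Qed.

Lemma Sq4_sqr P : Sq4 (P ^+ 2).
Proof. by exists P; rewrite subrr; left. Qed.

Lemma Sq4M D E : D != 0 -> E != 0 -> Sq4 D -> Sq4 E -> Sq4 (D * E).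
Proof.
move=> D0 E0 /(Sq4_root D0) [P [P0 vP hP]] /(Sq4_root E0) [R [R0 vR hR]].
exists (P * R).
have -> : D * E - (P * R) ^+ 2 = D * (E - R ^+ 2) + R ^+ 2 * (D - P ^+ 2) by ring.
rewrite vM //; apply: hvD; first by apply: hvW (hvM (hvv D) hR) _; lia.
by apply: hvW (hvM (hvv _) hP) _; rewrite vX //; lia.
Qed.

Lemma Sq4_mulsq D P : D != 0 -> P != 0 -> Sq4 (D * P ^+ 2) <-> Sq4 D.
Proof.
move=> D0 P0; split; last by move=> h; apply: Sq4M (expf_neq0 _ P0) h (Sq4_sqr P).
move=> h; have := Sq4M _ _ h (Sq4_sqr P^-1); rewrite exprVn mulfK ?expf_neq0 //.
by apply; rewrite ?mulf_neq0 ?invr_eq0 ?expf_neq0.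
Qed.

Lemma Sq4_mul D E : D != 0 -> E != 0 -> Sq4 E -> Sq4 (D * E) <-> Sq4 D.
Proof.
move=> D0 E0 sE; split; last by move=> sD; apply: Sq4M.
move=> h; have := Sq4M (mulf_neq0 D0 E0) E0 h sE.
by rewrite -mulrA -expr2; move/(Sq4_mulsq D0 E0).
Qed.

(* [t |-> e - t^2] contracts the residue class of an approximate root. *)
Lemma hensel_as e t : hv e 0 -> hv t 0 -> hv (t ^+ 2 + t - e) 2 ->
  exists l, l ^+ 2 + l = e.
Proof.
move=> he ht h.
pose T := fix T n := if n is m.+1 then e - T m ^+ 2 else t.
(* All iterates stay congruent to [t] modulo 2, so [T n.+1 + T n] is even and each step gains one
   factor 2. *)
have d n : [/\ hv (T n) 0, hv (T n - t) 2 & hv (T n.+1 - T n) (2 * n.+1%:Z)].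
  elim: n => [|n [h1 h2 h3]].
    split=> //=; first by rewrite subrr; left.
    have -> : e - t ^+ 2 - t = - (t ^+ 2 + t - e) by ring.
    exact: hvN.
  have h4 : hv (T n.+1) 0.
    by have := hvD (hvW h3 _) h1; rewrite subrK; apply; lia.
  have h5 : hv (T n.+1 - t) 2.
    have -> : T n.+1 - t = (T n.+1 - T n) + (T n - t) by ring.
    by apply: hvD => //; apply: hvW h3 _; lia.
  split=> //.
  have -> : T n.+2 - T n.+1 =
     - (T n.+1 - T n) * ((T n.+1 - t) + (T n - t) + 2 * t) by rewrite /=; ring.
  have h6 : hv (2 * t) 2 by apply: hvW (hvM (hvv 2) ht) _; rewrite (u2_two Hv).
  by apply: hvW (hvM (hvN h3) (hvD (hvD h5 h2) h6)) _; lia.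
have cau p q : (p <= q)%N -> hv (T q - T p) (2 * p.+1%:Z).
  move=> /subnKC <-; elim: (q - p)%N => [|m IH]; first by rewrite addn0 subrr; left.
  rewrite addnS; have [_ _ h3] := d (p + m)%N.
  have -> : T (p + m).+1 - T p = (T (p + m).+1 - T (p + m)%N) + (T (p + m)%N - T p) by ring.
  by apply: hvD => //; apply: hvW h3 _; lia.
have [l hl] : exists l, forall N : int, exists M, forall p, (M <= p)%N -> ord_ge v (T p - l) N.
  apply: (u2_complete Hv) => N; exists `|N|%N => p q hp hq; apply/hv_ge.
  case: (leqP p q) => pq.
    rewrite -opprB; apply: hvN; apply: hvW (cau _ _ pq) _; lia.
  by apply: hvW (cau _ _ (ltnW pq)) _; lia.
exists l; apply/eqP; rewrite -subr_eq0; apply: contraT => n0.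
have hl0 : hv l 0.
  have [M hM] := hl 0; have /hv_ge h0 := hM M (leqnn _).
  have [h1 _ _] := d M; rewrite mulr0 in h0.
  by have := hvB h1 h0; rewrite opprB addrC subrK.
(* [N] exceeds the order of [l ^+ 2 + l - e], so divisibility of this element by [2 ^ N] is
   absurd. *)
pose N : nat := `|v (l ^+ 2 + l - e)|.+1.
have [M hM] := hl N.
pose p := maxn M N.
have /hv_ge h1 := hM p (leq_maxl _ _).
have [h2 _ h3] := d p.
have : hv (l ^+ 2 + l - e) (2 * N%:Z).
  have -> : l ^+ 2 + l - e =
    - ((T p - l) * (T p + l + 1)) - (T p.+1 - T p) by rewrite /=; ring.
  apply: hvB; last by apply: hvW h3 _; lia.
  apply: hvN; rewrite -[2 * _]addr0; apply: hvM => //.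
  by apply: hvD; [apply: hvD|right; rewrite v1].
by move/(hvE n0); rewrite /N; set z := v _; lia.
Qed.

(** Write [D = P^2 (1 + 4 e)]. Since [(1 + 2 t)^2 = 1 + 4 (t^2 + t)], a residual root of
    [t^2 + t = e] lifts and makes [D] a square. Without one, [t^2 + t - e] is a unit for integral
    [t] and has order [2 * v t] otherwise; norms are [(2 P b)^2 (t^2 + t - e)], hence of even
    order. *)
Lemma Sq4_sq_or_unram D : D != 0 -> Sq4 D -> is_sq D \/ unram_quad v D.
Proof.
move=> D0 /(Sq4_root D0) [P [P0 vP hP]].
have t0 := two_neq0; have four0 : (4 : F) != 0.
  by rewrite -[4%:R]/((2 * 2)%N%:R) natrM mulf_neq0.
pose e := (D - P ^+ 2) / (4 * P ^+ 2).
have De : D = P ^+ 2 * (1 + 4 * e) by rewrite /e; field; rewrite P0 four0.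
have v4 : v 4 = 2.
  by rewrite -[4%:R]/((2 * 2)%N%:R) natrM vM // (u2_two Hv).
have he : hv e 0.
  apply: hvW (hv_div _ hP) _; rewrite ?mulf_neq0 ?expf_neq0 //.
  by rewrite vM ?expf_neq0 // v4 vX //; lia.
case: (classic (exists2 t, hv t 0 & hv (t ^+ 2 + t - e) 2)) => [[t ht h]|nt].
  have [l hl] := hensel_as he ht h.
  by left; exists (P * (1 + 2 * l)); rewrite De -hl; ring.
have big t : ~ hv t 0 -> [/\ t != 0, t ^+ 2 + t - e != 0 & v (t ^+ 2 + t - e) = 2 * v t].
  move=> nh; have t1 : t != 0 by apply/negP => /eqP t1; apply: nh; left.
  have vt : v t < 0 by case: (ltrP (v t) 0) => // h; case: nh; right; lia.
  have [h1 h2] : t ^+ 2 + (t - e) != 0 /\ v (t ^+ 2 + (t - e)) = v (t ^+ 2).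
    apply: hv_addE; rewrite ?expf_neq0 // vX //.
    by apply: hvB; [right; lia|apply: hvW he _; lia].
  by rewrite -addrA h2 vX.
have small t : hv t 0 -> t ^+ 2 + t - e != 0 /\ v (t ^+ 2 + t - e) = 0.
  move=> ht.
  have h0 : hv (t ^+ 2 + t - e) 0.
    by apply: hvB => //; apply: hvD => //; apply: hvW (hvX 2 ht) _; lia.
  have n0 : t ^+ 2 + t - e != 0.
    by apply/negP => /eqP h; apply: nt; exists t => //; rewrite h; left.
  split=> //; have := hvE n0 h0.
  case: (ltrP 0 (v (t ^+ 2 + t - e))) => h; last by lia.
  by case: nt; exists t => //; right; lia.
have nz t : t ^+ 2 + t - e != 0 /\ evz (v (t ^+ 2 + t - e)).
  case: (classic (hv t 0)) => ht.
    by have [h1 ->] := small t ht; split=> //; exists 0.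
  by have [_ h1 ->] := big t ht; split=> //; exists (v t).
right; split.
  move=> [y hy]; have [+ _] := nz ((y / P - 1) / 2); apply/negP; rewrite negbK.
  have -> : ((y / P - 1) / 2) ^+ 2 + (y / P - 1) / 2 - e =
     (y ^+ 2 / P ^+ 2 - (1 + 4 * e)) / 4 by field; rewrite t0 P0 four0.
  by rewrite -hy De mulrAC divff ?expf_neq0 // mul1r subrr mul0r.
move=> a b ab; apply/Nodd_absz.
have [b0|b0] := eqVneq b 0.
  case: ab => [a0|]; last by rewrite b0 eqxx.
  by rewrite b0 expr0n mulr0 subr0 vX //; exists (v a).
pose t := (a / (P * b) - 1) / 2.
have -> : a ^+ 2 - D * b ^+ 2 = (2 * P * b) ^+ 2 * (t ^+ 2 + t - e).
  by rewrite De /t; field; rewrite t0 P0 b0.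
have [n0 [h hh]] := nz t.
rewrite vM ?expf_neq0 ?mulf_neq0 // vX ?mulf_neq0 // hh.
by exists (v (2 * P * b) + h); lia.
Qed.

Lemma xi0_NSq4 D : xi_val v D 0 -> ~ Sq4 D.
Proof.
case=> [[//]|[[//]|[_ [D0 [ns nu]]]]] s.
by case: (Sq4_sq_or_unram D0 s).
Qed.

(** A norm of odd order is exhibited. If [v D] is odd, the norm of [sqrt D] serves. Otherwise
    [D = 2^(2 h) u] with [u] a unit congruent to [s^2] modulo 2; as [D] is not a square modulo 4,
    [u - s^2] has order exactly 1, and [2^h s + sqrt D] serves. *)
Lemma NSq4_xi0 D : D != 0 -> ~ Sq4 D -> xi_val v D 0.
Proof.
move=> D0 ns; right; right; split=> //; split=> //; split.
  by move=> [y hy]; apply: ns; rewrite hy; apply: Sq4_sqr.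
move=> [_ hu]; case: (evz_or_odz (v D)) => [[h vD]|o]; last first.
  have := hu 0 1; rewrite expr0n expr1n mulr1 sub0r vN oner_neq0.
  by move=> /(_ (or_intror isT)) /Nodd_absz /evz_odzF; apply.
have p0 := pow2z_neq0 h.
pose u := D / (2 ^ h) ^+ 2.
have Du : D = (2 ^ h) ^+ 2 * u by rewrite /u mulrC divfK ?expf_neq0.
have [s [s0 vs] hs] : exists2 s, unit_o v s & hv (u - s ^+ 2) 2.
  apply: residue_perfect; split; first by rewrite mulf_neq0 ?invr_eq0 ?expf_neq0.
  by rewrite vM ?invr_eq0 ?expf_neq0 // vV ?expf_neq0 // vX // v_pow2z; lia.
have vr : u - s ^+ 2 != 0 /\ v (u - s ^+ 2) = 1.
  have hn : ~ hv (u - s ^+ 2) 4.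
    move=> h4; apply: ns; exists (2 ^ h * s); rewrite Du exprMn -mulrBr -Du vD.
    by apply: hvW (hvM (hvv _) h4) _; rewrite vX // v_pow2z; lia.
  have r0 : u - s ^+ 2 != 0 by apply/negP => /eqP r0; apply: hn; left.
  split=> //; have := hvE r0 hs.
  by case: (ltrP 1 (v (u - s ^+ 2))) => h2; [case: hn; right|]; lia.
have := hu (2 ^ h * s) 1 (or_intror (oner_neq0 _)) => /Nodd_absz; rewrite expr1n mulr1.
have -> : (2 ^ h * s) ^+ 2 - D = - ((2 ^ h) ^+ 2 * (u - s ^+ 2)) by rewrite {1}Du; ring.
case: vr => r0 vr; rewrite vN vM ?expf_neq0 // vr vX // v_pow2z => [[g]]; lia.
Qed.

End Valuation.

(** * Splitting off planes *)

Section Decomposition.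
Variables (F : fieldType) (v : F -> int).
Hypothesis Hv : unram2adic v.
Local Notation hv := (hv v).
Local Notation Sq4 := (Sq4 v).

(** Each term of the Leibniz expansion uses every row and every column once, so all terms share this
    bound. *)
Lemma hv_det n (A : 'M[F]_n) (a b : 'I_n -> int) :
  (forall i j, hv (A i j) (a i + b j)) -> hv (\det A) (\sum_i a i + \sum_i b i).
Proof.
move=> h; apply: hv_sum => // s _.
have -> : \sum_i a i + \sum_i b i = 0 + \sum_i (a i + b (s i)).
  by rewrite add0r big_split /=; congr (_ + _); apply: (reindex_inj (@perm_inj _ s)).
apply: hvM => //; last by apply: hv_prod.
by case: (odd_perm s); right; rewrite ?expr1 ?expr0 ?(vN Hv) (v1 Hv).
Qed.

Lemma det2 (A : 'M[F]_2) : \det A = A 0 0 * A 1 1 - A 0 1 * A 1 0.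
Proof.
rewrite (expand_det_row _ 0) !big_ord_recl big_ord0 /cofactor !det_mx11 !mxE /=.
have e1 : lift (0 : 'I_2) 0 = 1 by apply: val_inj.
have e2 : lift (1 : 'I_2) 0 = 0 by apply: val_inj.
rewrite !e1 e2 expr0 expr1; ring.
Qed.

(* [A] is dominated by the norm with weights [a], the off-diagonal entries with
   an excess of [h/2]; [2B] satisfies this with [h = 0] when [a] is in [S(B)] *)
Definition wint (h : int) n (A : 'M[F]_n) (a : 'I_n -> int) : Prop :=
  [/\ A^T = A, forall i, hv (A i i) (2 * a i + 2) &
      forall i j, i != j -> hv (A i j) (a i + a j + h)].

Definition DA n (A : 'M[F]_n) : F := (-1) ^+ n./2 * \det A.

Definition qf n (A : 'M[F]_n) (c : 'cV[F]_n) : F := (c^T *m (A *m c)) 0 0.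

(* [c] is a vector of level [k] for the norm with weights [a] on which the
   quadratic form has exact value [k] and which is orthogonal to the basis
   vectors up to an excess of [h/2] *)
Definition open_vec n (A : 'M[F]_n) (a : 'I_n -> int) (k h : int) (c : 'cV[F]_n) : Prop :=
  [/\ forall j, hv (c j 0) (k - a j), qf A c != 0, v (qf A c) = k + 1 &
      forall j, hv ((A *m c) j 0) (k + a j + h)].

(** Levels of opposite parity: scaling by powers of 2 shifts a level by even amounts, so such a pair
    yields open vectors of every level. *)
Definition open_pair n (A : 'M[F]_n) a h : Prop :=
  exists k c k' c', [/\ odz (k + k'), open_vec A a k h c & open_vec A a k' h c'].

(** The first clause in each parity bounds the weights by the determinant; the others treat the
    cases of equality that yield open vectors. In odd rank the value of the open vector is moreover
    tied to [D] up to squares modulo 4. *)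
Definition splitting n (A : 'M[F]_n) (a : 'I_n -> int) : Prop :=
  let S := \sum_i a i in let D := DA A in
  if odd n then
    hv D (2 * S + 2) /\
    (D != 0 -> v D = S + 1 ->
      exists k c, open_vec A a k 2 c /\ exists P, hv (D - qf A c * P ^+ 2) (2 * v D + 4))
  else
    [/\ exists P, hv (D - P ^+ 2) (2 * S + 4) /\ hv P S,
        D != 0 -> v D = S + 1 -> ~ Sq4 D -> open_pair A a 1 &
        D != 0 -> v D = S + 2 -> odz (v D) -> open_pair A a 2].

Lemma wint_entry h n (A : 'M[F]_n) a : wint h A a -> h <= 2 ->
  forall i j, hv (A i j) (a i + a j + h).
Proof.
move=> [_ h1 h2] hh i j; have [->|ij] := eqVneq i j; last exact: h2.
by apply: hvW (h1 j) _; lia.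
Qed.

Lemma hv_DA n (A : 'M[F]_n) k : hv (\det A) k -> hv (DA A) k.
Proof.
move=> h; rewrite /DA; have -> : k = 0 + k by rewrite add0r.
apply: hvM => //; right; rewrite (vX Hv) ?oppr_eq0 ?oner_neq0 //.
by rewrite (vN Hv) (v1 Hv); lia.
Qed.

(** * Invariance under permutations of the basis *)

Section Permute.
Variables (n : nat) (A : 'M[F]_n) (a : 'I_n -> int) (s : 'S_n).
Let A' : 'M[F]_n := \matrix_(i, j) A (s i) (s j).
Let a' i := a (s i).

Lemma DA_perm : DA A' = DA A.
Proof.
rewrite /DA; congr (_ * _).
have -> : A' = row_perm s (col_perm s A) by apply/matrixP => i j; rewrite !mxE.
rewrite row_permE col_permE !det_mulmx !det_perm odd_permV mulrCA -expr2 sqrr_sign.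
by rewrite mulr1.
Qed.

Let lift (c : 'cV[F]_n) : 'cV[F]_n := \col_i c (s^-1 i)%g 0.

Lemma mul_lift c i : (A *m lift c) (s i) 0 = (A' *m c) i 0.
Proof.
rewrite !mxE (reindex_inj (@perm_inj _ s)); apply: eq_bigr => j _.
by rewrite !mxE permK.
Qed.

Lemma qf_lift c : qf A (lift c) = qf A' c.
Proof.
rewrite /qf !mxE (reindex_inj (@perm_inj _ s)); apply: eq_bigr => j _.
by rewrite mul_lift !mxE permK.
Qed.

Lemma open_vec_lift k h c : open_vec A' a' k h c -> open_vec A a k h (lift c).
Proof.
move=> [h1 h2 h3 h4]; split; rewrite ?qf_lift // => j.
  by rewrite mxE; have := h1 (s^-1 j)%g; rewrite /a' permKV.
by have := h4 (s^-1 j)%g; rewrite -mul_lift /a' permKV.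
Qed.

Lemma open_pair_perm h : open_pair A' a' h -> open_pair A a h.
Proof.
move=> [k [c [k' [c' [h1 h2 h3]]]]].
by exists k, (lift c), k', (lift c'); split=> //; apply: open_vec_lift.
Qed.

Lemma splitting_perm : splitting A' a' -> splitting A a.
Proof.
rewrite /splitting DA_perm.
have <- : \sum_i a i = \sum_i a' i by apply: (reindex_inj (@perm_inj _ s)).
case: (odd n).
  move=> [h1 h2]; split=> // D0 vD; have [k [c [h3 h4]]] := h2 D0 vD.
  by exists k, (lift c); rewrite qf_lift; split=> //; apply: open_vec_lift.
move=> [h1 h2 h3]; split=> //.
  by move=> D0 vD ns; apply: open_pair_perm; apply: h2.
by move=> D0 vD o; apply: open_pair_perm; apply: h3.
Qed.

Lemma wint_perm h : wint h A a -> wint h A' a'.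
Proof.
move=> [h1 h2 h3]; split.
- by apply/matrixP => i j; rewrite !mxE -[in LHS]h1 mxE.
- by move=> i; rewrite mxE; apply: h2.
- by move=> i j ij; rewrite mxE; apply: h3; rewrite (inj_eq (@perm_inj _ s)).
Qed.

End Permute.

(** * The orthogonal complement of a sharp plane *)

Section Pivot.
Variables (m : nat) (A : 'M[F]_(2 + m)) (a : 'I_(2 + m) -> int) (h : int).
Let i0 : 'I_(2 + m) := @lshift 2 m 0.
Let i1 : 'I_(2 + m) := @lshift 2 m 1.
Let r : F := A i0 i1.
Hypotheses (h0 : 0 <= h) (h1 : h <= 1) (HA : wint h A a)
  (r0 : r != 0) (vr : 2 * v r = a i0 + a i1 + h).
Let p : F := A i0 i0.
Let q : F := A i1 i1.
Definition pivD := r ^+ 2 - p * q.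
Let al k : F := A i0 (rshift 2 k).
Let be k : F := A i1 (rshift 2 k).
(** Coordinates of the projection onto the plane, by Cramer's rule; [pivA] is then the Schur
    complement. *)
Let w : 'M[F]_(2, m) := \matrix_(i, k)
  (if i == 0 then (r * be k - q * al k) / pivD else (r * al k - p * be k) / pivD).
Definition pivA : 'M[F]_m := drsubmx A - w^T *m ursubmx A.
Definition piva k := a (rshift 2 k).

Let symA i j : A i j = A j i.
Proof. by have [e _ _] := HA; rewrite -[in LHS]e mxE. Qed.

Let hp : hv p (2 * a i0 + 2). Proof. by have [_ e _] := HA; apply: e. Qed.
Let hq : hv q (2 * a i1 + 2). Proof. by have [_ e _] := HA; apply: e. Qed.
Let hal k : hv (al k) (a i0 + piva k + h). Proof. by apply: (wint_entry HA); lia. Qed.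
Let hbe k : hv (be k) (a i1 + piva k + h). Proof. by apply: (wint_entry HA); lia. Qed.
Let hr : hv r (a i0 + a i1 + h). Proof. by right; lia. Qed.

(** Diagonal entries carry an extra factor 2, so [p * q] has larger order than [r ^+ 2] as long as
    [h <= 1]. *)
Lemma pivD_v : pivD != 0 /\ v pivD = a i0 + a i1 + h.
Proof.
have [] := @hv_addE F v Hv (r ^+ 2) (- (p * q)); rewrite ?expf_neq0 ?(vX Hv) //.
  by apply: hvN => //; apply: hvW (hvM Hv hp hq) _; lia.
by move=> n0 e; split; rewrite /pivD // e; lia.
Qed.

Let d0 : pivD != 0. Proof. by case: pivD_v. Qed.

Let hw0 k : hv (w 0 k) (piva k - a i0).
Proof.
rewrite mxE /=; have [_ vd] := pivD_v.
have e : hv (r * be k - q * al k) (piva k + 2 * a i1 + a i0 + 2 * h).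
  apply: hvB => //; first by apply: hvW (hvM Hv hr (hbe k)) _; lia.
  by apply: hvW (hvM Hv hq (hal k)) _; lia.
by apply: hvW (hv_div Hv d0 e) _; rewrite vd; lia.
Qed.

Let hw1 k : hv (w 1 k) (piva k - a i1).
Proof.
rewrite mxE /=; have [_ vd] := pivD_v.
have e : hv (r * al k - p * be k) (piva k + a i1 + 2 * a i0 + 2 * h).
  apply: hvB => //; first by apply: hvW (hvM Hv hr (hal k)) _; lia.
  by apply: hvW (hvM Hv hp (hbe k)) _; lia.
by apply: hvW (hv_div Hv d0 e) _; rewrite vd; lia.
Qed.

Let sum2 (f : 'I_2 -> F) : \sum_i f i = f 0 + f 1.
Proof. by rewrite big_ord_recl big_ord1; congr (_ + f _); apply: val_inj. Qed.

Let pivAE k l : pivA k l =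
  A (rshift 2 k) (rshift 2 l) - (w 0 k * al l + w 1 k * be l).
Proof. by rewrite !mxE sum2 !mxE. Qed.

Let wsolve : ulsubmx A *m w = ursubmx A.
Proof.
apply/matrixP => i k; rewrite !mxE sum2 !mxE /=.
have [->|->] : i = 0 \/ i = 1 by case: i => [[|[|//]] ?]; [left|right]; apply: val_inj.
  rewrite -/i0 -/i1 -/r -/p -/(al k) -/(be k).
  by move: d0; rewrite /pivD => d0'; field.
rewrite -/i0 -/i1 (symA i1 i0) -/r -/q -/(al k) -/(be k).
by move: d0; rewrite /pivD => d0'; field.
Qed.

Let tr_ur : (ursubmx A)^T = dlsubmx A.
Proof. by apply/matrixP => i k; rewrite !mxE symA. Qed.

Let tr_ul : (ulsubmx A)^T = ulsubmx A.
Proof. by apply/matrixP => i k; rewrite !mxE symA. Qed.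

Let wsym : w^T *m ursubmx A = dlsubmx A *m w.
Proof. by rewrite -wsolve -tr_ur -wsolve trmx_mul tr_ul mulmxA. Qed.

Let pivA2 : pivA = drsubmx A - dlsubmx A *m w.
Proof. by rewrite /pivA wsym. Qed.

Lemma pivA_wint : wint h pivA piva.
Proof.
have [_ hd ho] := HA; split.
- have tr_dr : (drsubmx A)^T = drsubmx A by apply/matrixP => i k; rewrite !mxE symA.
  by rewrite {1}/pivA linearB /= trmx_mul trmxK tr_ur tr_dr -pivA2.
- move=> k; rewrite pivAE.
  apply: hvB => //.
  have [_ vd] := pivD_v.
  (* Estimating the two products separately loses the diagonal gain; over the common denominator the
     cross term shows its factor 2. *)
  have -> : w 0 k * al k + w 1 k * be k =
      (2 * (r * (al k * be k)) - q * (al k * al k) - p * (be k * be k)) / pivD.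
    by rewrite !mxE /=; move: d0; rewrite /pivD => d0'; field.
  have e : hv (2 * (r * (al k * be k)) - q * (al k * al k) - p * (be k * be k))
              (2 * piva k + 2 + 2 * a i0 + 2 * a i1 + 2 * h).
    have h2 : hv 2 2 by right; rewrite (u2_two Hv).
    apply: hvB => //; first apply: hvB => //.
    + by apply: hvW (hvM Hv h2 (hvM Hv hr (hvM Hv (hal k) (hbe k)))) _; lia.
    + by apply: hvW (hvM Hv hq (hvM Hv (hal k) (hal k))) _; lia.
    + by apply: hvW (hvM Hv hp (hvM Hv (hbe k) (hbe k))) _; lia.
  by apply: hvW (hv_div Hv d0 e) _; rewrite vd; lia.
- move=> k l kl; rewrite pivAE; apply: hvB => //.
    by apply: ho; rewrite (inj_eq (@rshift_inj _ _)).
  by apply: hvD => //; [apply: hvW (hvM Hv (hw0 k) (hal l)) _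
                       |apply: hvW (hvM Hv (hw1 k) (hbe l)) _]; lia.
Qed.

(** The plane has determinant [- pivD]; the sign built into [DA] absorbs the minus. *)
Lemma pivA_DA : DA A = pivD * DA pivA.
Proof.
have T1 : A *m block_mx 1%:M (- w) 0 1%:M = block_mx (ulsubmx A) 0 (dlsubmx A) pivA.
  rewrite -{1}[A]submxK mulmx_block !mulmx1 !mulmx0 !mulmxN wsolve !addr0.
  by rewrite addNr pivA2 [- _ + _]addrC.
have e := congr1 determinant T1.
rewrite det_mulmx det_ublock !det1 !mulr1 det_lblock in e.
have e2 : \det (ulsubmx A) = - pivD.
  rewrite det2 !mxE -/i0 -/i1 (symA i1 i0) -/r -/p -/q /pivD; ring.
rewrite /DA e e2 -[in LHS]/(2 + m)%N halfD /= add0n exprS; ring.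
Qed.

(** Embedding of the complement: the image is exactly orthogonal to the plane, so openness and the
    value of the form are preserved. *)
Definition plift (c : 'cV[F]_m) : 'cV[F]_(2 + m) := col_mx (- (w *m c)) c.

Let mul_plift c : A *m plift c = col_mx 0 (pivA *m c).
Proof.
rewrite -{1}[A]submxK mul_block_col !mulmxN !mulmxA wsolve addNr.
by rewrite pivA2 mulmxBl [- _ + _]addrC.
Qed.

Lemma qf_plift c : qf A (plift c) = qf pivA c.
Proof. by rewrite /qf mul_plift tr_col_mx mul_row_col mulmx0 add0r. Qed.

Lemma open_vec_plift k g c : open_vec pivA piva k g c -> open_vec A a k g (plift c).
Proof.
move=> [c1 c2 c3 c4]; split; rewrite ?qf_plift // => j.
  case: (split_ordP j) => j' ->; last by rewrite col_mxEd; apply: c1.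
  rewrite col_mxEu mxE; apply: hvN => //; rewrite mxE; apply: hv_sum => // l _.
  have [->|->] : j' = 0 \/ j' = 1 by case: j' => [[|[|//]] ?]; [left|right]; apply: val_inj.
    by apply: hvW (hvM Hv (hw0 l) (c1 l)) _; rewrite -/i0; lia.
  by apply: hvW (hvM Hv (hw1 l) (c1 l)) _; rewrite -/i1; lia.
rewrite mul_plift; case: (split_ordP j) => j' ->; last by rewrite col_mxEd; apply: c4.
by rewrite col_mxEu mxE; left.
Qed.

Lemma open_pair_plift g : open_pair pivA piva g -> open_pair A a g.
Proof.
move=> [k [c [k' [c' [o1 o2 o3]]]]].
by exists k, (plift c), k', (plift c'); split=> //; apply: open_vec_plift.
Qed.

Lemma piv_sum : \sum_i a i = a i0 + a i1 + \sum_k piva k.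
Proof.
rewrite big_split_ord /= big_ord_recl big_ord1.
by congr (_ + a _ + _); apply: val_inj.
Qed.

(** For [h = 0] this makes [pivD] a square modulo 4, so removing the plane does not affect whether
    [D] is one. *)
Lemma pivD_decomp : hv (pivD - r ^+ 2) (2 * (a i0 + a i1) + 4).
Proof.
have -> : pivD - r ^+ 2 = - (p * q) by rewrite /pivD; ring.
by apply: hvN => //; apply: hvW (hvM Hv hp hq) _; lia.
Qed.

End Pivot.

End Decomposition.

(** * Determinant bounds by induction on the rank and on the excess *)

Section Splitting.
Variables (F : fieldType) (v : F -> int).
Hypothesis Hv : unram2adic v.
Local Notation hv := (hv v).
Local Notation Sq4 := (Sq4 v).
Local Notation wint := (wint v).
Local Notation splitting := (splitting v).
Local Notation open_vec := (open_vec v).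
Local Notation open_pair := (open_pair v).

(** Doubled orders are integers: if no off-diagonal entry attains its bound, all bounds improve by
    1. *)
Lemma pivot_or h n (A : 'M[F]_n) a : wint h A a ->
  (exists i j, [/\ i != j, A i j != 0 & 2 * v (A i j) = a i + a j + h]) \/ wint (h + 1) A a.
Proof.
move=> [h1 h2 h3].
case: (classic (exists i j, [/\ i != j, A i j != 0 & 2 * v (A i j) = a i + a j + h]));
  first by left.
move=> nx; right; split=> // i j ij; have [->|A0] := eqVneq (A i j) 0; first by left.
right; have := hvE A0 (h3 i j ij).
case: (eqVneq (2 * v (A i j)) (a i + a j + h)) => e; last by lia.
by case: nx; exists i, j.
Qed.

Lemma front_perm m (i j : 'I_m.+2) : i != j ->
  exists s : 'S_m.+2, s (@lshift 2 m 0) = i /\ s (@lshift 2 m 1) = j.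
Proof.
set i0 : 'I_m.+2 := @lshift 2 m 0; set i1 : 'I_m.+2 := @lshift 2 m 1 => ij.
have i01 : i0 != i1 by [].
exists (tperm i1 (tperm i0 i j) * tperm i0 i)%g; rewrite !permM; split.
  have t0 : tperm i0 i j != i0.
    by rewrite -(inj_eq (@perm_inj _ (tperm i0 i))) tpermK tpermL eq_sym.
  by rewrite (@tpermD _ i1 (tperm i0 i j) i0) ?tpermL // eq_sym.
by rewrite tpermL tpermK.
Qed.

Lemma qf_delta n (A : 'M[F]_n) i : qf A (delta_mx i 0) = A i i.
Proof.
rewrite /qf trmx_delta mxE (bigD1 i) //= big1 => [|j ji].
  rewrite mxE !eqxx mul1r addr0 mxE (bigD1 i) //= big1 => [|j ji].
    by rewrite mxE !eqxx mulr1 addr0.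
  by rewrite mxE (negPf ji) mulr0.
by rewrite mxE (negPf ji) andbF mul0r.
Qed.

Lemma open_vec_delta n (A : 'M[F]_n) a i h : A i i != 0 -> v (A i i) = a i + 1 ->
  (forall j, hv (A j i) (a i + a j + h)) -> open_vec A a (a i) h (delta_mx i 0).
Proof.
move=> A0 vA hA; split; rewrite ?qf_delta // => j.
  rewrite mxE andbT; have [->|_] := eqVneq; last by left.
  by right; rewrite (v1 Hv); lia.
rewrite mxE (bigD1 i) //= big1 => [|k ki]; first by rewrite mxE !eqxx mulr1 addr0.
by rewrite mxE (negPf ki) mulr0.
Qed.

(** With excess 2 the diagonal and off-diagonal bounds agree, and each weight may be replaced by
    [a i + 1]. *)
Lemma wint2_DA n (A : 'M[F]_n) a : wint 2 A a -> hv (DA A) (2 * (\sum_i a i) + 2 * n%:Z).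
Proof.
move=> h; apply: hv_DA => //.
have e : forall i j, hv (A i j) ((a i + 1) + (a j + 1)).
  by move=> i j; apply: hvW (wint_entry h _ i j) _; lia.
have e1 : \sum_i (a i + 1) = \sum_i a i + n%:Z by rewrite big_split /= sumr_const card_ord natz.
by apply: hvW (hv_det Hv e) _; rewrite e1; lia.
Qed.

(** No sharp plane is left. Ranks 0, 1 and 2 are computed directly; from rank 3 on the determinant
    is too divisible for equality to occur. *)
Lemma wint2_splitting n (A : 'M[F]_n) a : wint 2 A a -> splitting A a.
Proof.
case: n A a => [|[|[|n]]] A a hA; have hD := wint2_DA hA; move: hA => [hs hd ho].
- have D1 : DA A = 1 by rewrite /DA det_mx00 mulr1.
  rewrite /splitting /= D1 big_ord0; split.
  + exists 1; rewrite expr1n subrr; split; first by left.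
    by right; rewrite (v1 Hv).
  + by rewrite (v1 Hv).
  + by rewrite (v1 Hv).
- have D1 : DA A = A 0 0 by rewrite /DA det_mx11 mul1r.
  rewrite /splitting /= D1 big_ord1; split=> [|A0 vA]; first exact: hd.
  exists (a 0), (delta_mx 0 0); split.
    by apply: open_vec_delta => // j; rewrite ord1; apply: hvW (hd _) _; lia.
  by exists 1; rewrite qf_delta expr1n mulr1 subrr; left.
- pose o0 : 'I_2 := 0; pose o1 : 'I_2 := 1.
  have S2 : \sum_i a i = a o0 + a o1.
    by rewrite big_ord_recl big_ord1; congr (_ + a _); apply: val_inj.
  have D2 : DA A = A o0 o1 ^+ 2 - A o0 o0 * A o1 o1.
    have e : A o1 o0 = A o0 o1 by rewrite -[in LHS]hs mxE.
    rewrite /DA det2 // -/o0 -/o1 e /= expr1; ring.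
  rewrite S2 in hD.
  rewrite /splitting /= S2; split.
  + exists 0; rewrite expr0n subr0; split; last by left.
    by apply: hvW hD _; lia.
  + by move=> D0 vD; have := hvE D0 hD; lia.
  + move=> D0 vD o; have h0 := hd o0; have h1 := hd o1.
    have h01 : hv (A o0 o1) (a o0 + a o1 + 2) by apply: ho.
    (* Were the diagonal product smaller, [D] would have the even order of [A o0 o1 ^+ 2]. Hence
       both diagonal entries are sharp. *)
    have nh : ~ hv (A o0 o0 * A o1 o1) (2 * (a o0 + a o1) + 5).
      move=> hp.
      have [] := hv_eqv Hv D0 (y := A o0 o1 ^+ 2).
        rewrite D2 addrAC subrr add0r -D2; apply: hvN => //.
        by apply: hvW hp _; lia.
      rewrite expf_eq0 /= => B0; rewrite (vX Hv) // => e.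
      by apply: (@evz_odzF (v (DA A))) => //; exists (v (A o0 o1)); lia.
    have ex i : (i == o0) || (i == o1) -> A i i != 0 /\ v (A i i) = a i + 1.
      move=> hi; have n0 : ~ hv (A i i) (2 * a i + 3).
        move=> hA; apply: nh; case/orP: hi => /eqP e; rewrite e in hA.
          by apply: hvW (hvM Hv hA h1) _; lia.
        by apply: hvW (hvM Hv h0 hA) _; lia.
      have A0 : A i i != 0 by apply/negP => /eqP e; apply: n0; left.
      split=> //; have := hvE A0 (hd i).
      case: (ltrP (a i + 1) (v (A i i))) => // l; last by lia.
      by case: n0; right; lia.
    have [A0 vA0] := ex o0 isT; have [A1 vA1] := ex o1 isT.
    exists (a o0), (delta_mx o0 0), (a o1), (delta_mx o1 0); split.
    * by case: o => g o; exists (g - 1); lia.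
    * apply: open_vec_delta => // j; apply: hvW (@wint_entry _ _ 2 _ _ _ _ _ j o0) _ => //; lia.
    * apply: open_vec_delta => // j; apply: hvW (@wint_entry _ _ 2 _ _ _ _ _ j o1) _ => //; lia.
- rewrite /splitting; case: ifP => _.
    split; first by apply: hvW hD _; lia.
    by move=> D0 vD; have := hvE D0 hD; lia.
  split.
  + exists 0; rewrite expr0n subr0; split; last by left.
    by apply: hvW hD _; lia.
  + by move=> D0 vD; have := hvE D0 hD; lia.
  + by move=> D0 vD; have := hvE D0 hD; lia.
Qed.

(** The induction for excess 1 needs the extra divisibility of [D], valid in every positive rank. *)
Definition splitting_half n (A : 'M[F]_n) a : Prop :=
  splitting A a /\ ((0 < n)%N -> hv (DA A) (2 * (\sum_i a i) + 2)).

(** Here [D] is the plane itself. If it is not a square modulo 4, both diagonal entries are sharp,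
    and the two basis vectors form an open pair: their weights add up to [2 * v r - 1], [r] being
    the off-diagonal entry. *)
Lemma splitting_half_piv0 (A : 'M[F]_(2 + 0)) a :
  wint 1 A a -> A (@lshift 2 0 0) (@lshift 2 0 1) != 0 ->
  2 * v (A (@lshift 2 0 0) (@lshift 2 0 1)) = a (@lshift 2 0 0) + a (@lshift 2 0 1) + 1 ->
  splitting_half A a.
Proof.
move=> hA r0 vr.
have i01 : (0 : int) <= 1 by []. have i11 : (1 : int) <= 1 by [].
have [d0 vd] := pivD_v Hv i01 i11 hA r0 vr.
have eD := pivA_DA Hv i01 i11 hA r0 vr.
have eS := piv_sum a; rewrite big_ord0 addr0 in eS.
have hd := pivD_decomp Hv i01 i11 hA r0 vr.
have eD1 : DA (pivA A) = 1 by rewrite /DA det_mx00 mulr1.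
rewrite eD1 mulr1 in eD.
rewrite /splitting_half /splitting /= eS eD; split; last by move=> _; right; rewrite vd; lia.
have [_ hdiag _] := hA.
set i := @lshift 2 0 0 in r0 vr vd hd *; set j := @lshift 2 0 1 in r0 vr vd hd *.
split.
- exists (A i j); split; first by apply: hvW hd _; lia.
  by right; lia.
- move=> D0 vD ns.
  have ex l : (l == i) || (l == j) -> A l l != 0 /\ v (A l l) = a l + 1.
    move=> hl; have n0 : ~ hv (A l l) (2 * a l + 3).
      move=> hA'; apply: ns; exists (A i j).
      have -> : pivD A - A i j ^+ 2 = - (A i i * A j j) by rewrite /pivD -/i -/j; ring.
      apply: hvN => //; rewrite vd; case/orP: hl => /eqP e; rewrite e in hA'.
        have := hv_round (hvW (hvM Hv (hv_round (k := a i + 2) (hvW hA' _)) (hdiag j)) _).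
        by move=> /(_ (a i + a j + 3)) H; apply: hvW (H _ _) _; lia.
      have := hv_round (hvW (hvM Hv (hdiag i) (hv_round (k := a j + 2) (hvW hA' _))) _).
      by move=> /(_ (a i + a j + 3)) H; apply: hvW (H _ _) _; lia.
    have A0 : A l l != 0 by apply/negP => /eqP e; apply: n0; left.
    split=> //; have := hvE A0 (hdiag l).
    case: (ltrP (a l + 1) (v (A l l))) => // lt; last by lia.
    by case: n0; right; lia.
  have [A0 vA0] : A i i != 0 /\ v (A i i) = a i + 1 by apply: ex; rewrite eqxx.
  have [A1 vA1] : A j j != 0 /\ v (A j j) = a j + 1.
    by apply: ex; rewrite eqxx orbT.
  exists (a i), (delta_mx i 0), (a j), (delta_mx j 0); split.
  + by exists (v (A i j) - 1); lia.
  + by apply: open_vec_delta => // l; apply: hvW (wint_entry hA _ l i) _; lia.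
  + by apply: open_vec_delta => // l; apply: hvW (wint_entry hA _ l j) _; lia.
- by move=> D0; rewrite vd; lia.
Qed.

(** A plane of excess 1 next to a nonzero complement makes [D] divisible enough to rule out all
    cases of equality. *)
Lemma splitting_half_piv m (A : 'M[F]_(2 + m)) a :
  wint 1 A a -> A (@lshift 2 m 0) (@lshift 2 m 1) != 0 ->
  2 * v (A (@lshift 2 m 0) (@lshift 2 m 1)) = a (@lshift 2 m 0) + a (@lshift 2 m 1) + 1 ->
  (0 < m)%N -> splitting_half (pivA A) (piva a) -> splitting_half A a.
Proof.
move=> hA r0 vr mpos [P1 P2].
have i01 : (0 : int) <= 1 by []. have i11 : (1 : int) <= 1 by [].
have [d0 vd] := pivD_v Hv i01 i11 hA r0 vr.
have eD := pivA_DA Hv i01 i11 hA r0 vr.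
have eS := piv_sum a.
have hd := pivD_decomp Hv i01 i11 hA r0 vr.
have od : odd (2 + m) = odd m by rewrite /= negbK.
move: P1; rewrite /splitting_half /splitting od eS eD.
set S' := \sum_k piva a k in P2 *.
set D := DA (pivA A) in P2 *; set dl := pivD A in d0 vd hd *.
set a0 := a _ in vr vd hd *; set a1 := a _ in vr vd hd *; set r := A _ _ in r0 vr hd.
have hdv : hv dl (2 * (a0 + a1 + 1)) by right; lia.
have hD := P2 mpos.
case: ifP => _.
  move=> [H1 H2]; split; last by move=> _; apply: hvW (hvM Hv hdv hD) _; lia.
  split; first by apply: hvW (hvM Hv hdv hD) _; lia.
  move=> D0 vD; have := hvE D0 (hvM Hv hdv hD); lia.
move=> [[P [H1 H1']] H2 H3]; split; last by move=> _; apply: hvW (hvM Hv hdv hD) _; lia.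
split.
- exists 0; rewrite expr0n subr0; split; last by left.
  by apply: hvW (hvM Hv hdv hD) _; lia.
- by move=> D0 vD; have := hvE D0 (hvM Hv hdv hD); lia.
- move=> D0 vD o; exfalso.
  have D0' : D != 0 by apply: contraNneq D0 => ->; rewrite mulr0.
  move: vD o; rewrite (vM Hv) // vd => vD o.
  (* Now [v D = S' + 1], so the congruence gives [v D = 2 * v P]; since also [v dl = 2 * v r], the
     total order is even. *)
  have [] := hv_eqv Hv D0' (y := P ^+ 2); first by apply: hvW H1 _; lia.
  rewrite expf_eq0 /= => P0; rewrite (vX Hv) // => e.
  by apply: (evz_odzF _ o); exists (v r + v P); lia.
Qed.
Lemma splitting_half_perm n (A : 'M[F]_n) a (s : 'S_n) :
  splitting_half (\matrix_(i, j) A (s i) (s j)) (fun i => a (s i)) -> splitting_half A a.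
Proof.
move=> [h1 h2]; split; first exact: splitting_perm h1.
move=> n0; have := h2 n0; rewrite DA_perm.
by have <- : \sum_i a i = \sum_i a (s i) by apply: (reindex_inj (@perm_inj _ s)).
Qed.

Lemma wint1_splitting n (A : 'M[F]_n) a : wint 1 A a -> splitting_half A a.
Proof.
elim/ltn_ind: n A a => n IH A a hA.
case: (pivot_or hA) => [[i [j [ij A0 vA]]]|hA2]; last first.
  split; first exact: wint2_splitting.
  by move=> n0; apply: hvW (wint2_DA hA2) _; lia.
case: n A a IH hA i j ij A0 vA => [|[|m]] A a IH hA i j ij A0 vA; first by case: i ij A0 vA.
  by move: ij; rewrite !ord1 eqxx.
have [s [s0 s1]] := front_perm ij.
apply: (@splitting_half_perm _ _ _ s).
have hA' := wint_perm s hA.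
set A' := \matrix_(_, _) _ in hA' *; set a' := fun _ => _ in hA' *.
have r0 : A' (@lshift 2 m 0) (@lshift 2 m 1) != 0 by rewrite mxE s0 s1.
have vr : 2 * v (A' (@lshift 2 m 0) (@lshift 2 m 1)) =
    a' (@lshift 2 m 0) + a' (@lshift 2 m 1) + 1 by rewrite mxE /a' s0 s1.
move: A' a' hA' r0 vr => A' a' hA' r0 vr.
case: m A a IH hA i j ij A0 vA s s0 s1 A' a' hA' r0 vr
  => [|m] A a IH hA i j ij A0 vA s s0 s1 A' a' hA' r0 vr.
  exact: splitting_half_piv0 hA' r0 vr.
apply: (splitting_half_piv hA' r0 vr) => //; apply: IH => //.
exact: (pivA_wint Hv _ _ hA' r0 vr).
Qed.

(** A plane of excess 0 has discriminant [r ^+ 2] modulo 4 and order equal to the sum of its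
    weights, so every clause transfers from the complement. *)
Lemma splitting_piv m (A : 'M[F]_(2 + m)) a :
  wint 0 A a -> A (@lshift 2 m 0) (@lshift 2 m 1) != 0 ->
  2 * v (A (@lshift 2 m 0) (@lshift 2 m 1)) = a (@lshift 2 m 0) + a (@lshift 2 m 1) + 0 ->
  splitting (pivA A) (piva a) -> splitting A a.
Proof.
move=> hA r0 vr P1.
have i01 : (0 : int) <= 0 by []. have i11 : (0 : int) <= 1 by [].
have [d0 vd] := pivD_v Hv i01 i11 hA r0 vr.
have eD := pivA_DA Hv i01 i11 hA r0 vr.
have eS := piv_sum a.
have hd := pivD_decomp Hv i01 i11 hA r0 vr.
have od : odd (2 + m) = odd m by rewrite /= negbK.
have lift1 k c := @open_vec_plift _ _ Hv _ _ _ _ i01 i11 hA r0 vr k 2 c.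
have lift2 g := @open_pair_plift _ _ Hv _ _ _ _ i01 i11 hA r0 vr g.
have qfl c := @qf_plift _ _ Hv _ _ _ _ i01 i11 hA r0 vr c.
move: P1; rewrite /splitting od eS eD.
set S' := \sum_k piva a k.
set D := DA (pivA A); set dl := pivD A in d0 vd hd *.
set a0 := a _ in vr vd hd *; set a1 := a _ in vr vd hd *; set r := A _ _ in r0 vr hd.
have hdv : hv dl (2 * (a0 + a1)) by right; lia.
have sdl : Sq4 dl by exists r; apply: hvW hd _; lia.
have DD0 : dl * D != 0 -> D != 0 by apply: contraNneq => ->; rewrite mulr0.
case: ifP => _.
  move=> [H1 H2]; split; first by apply: hvW (hvM Hv hdv H1) _; lia.
  move=> D0 vD; have D0' := DD0 D0; move: vD; rewrite (vM Hv) // => vD.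
  have vD2 : v D = S' + 1 by lia.
  have [k [c [o [P hP]]]] := H2 D0' vD2.
  exists k, (plift A c); split; first exact: lift1.
  exists (r * P); rewrite qfl.
  have -> : dl * D - qf (pivA A) c * (r * P) ^+ 2 =
     dl * (D - qf (pivA A) c * P ^+ 2) +  (dl - r ^+ 2) * (qf (pivA A) c * P ^+ 2) by ring.
  have hqP : hv (qf (pivA A) c * P ^+ 2) (2 * v D).
    have -> : qf (pivA A) c * P ^+ 2 = D - (D - qf (pivA A) c * P ^+ 2) by ring.
    by apply: hvB => //; [apply: hvv|apply: hvW hP _; lia].
  apply: hvD => //; first by apply: hvW (hvM Hv hdv hP) _; lia.
  by apply: hvW (hvM Hv hd hqP) _; lia.
move=> [[P [H1 H1']] H2 H3]; split.
- exists (r * P); split; last first.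
    by apply: hvW (hvM Hv (hvv v r) H1') _; lia.
  have -> : dl * D - (r * P) ^+ 2 = dl * (D - P ^+ 2) + (dl - r ^+ 2) * P ^+ 2 by ring.
  apply: hvD => //; first by apply: hvW (hvM Hv hdv H1) _; lia.
  by apply: hvW (hvM Hv hd (hvX Hv 2 H1')) _; lia.
- move=> D0; have D0' := DD0 D0; rewrite (vM Hv) // => vD ns.
  apply: lift2; apply: H2 => //; first by lia.
  by move=> sD; apply: ns; apply: Sq4M.
- move=> D0; have D0' := DD0 D0; rewrite (vM Hv) // => vD ns.
  apply: lift2; apply: H3 => //; first by lia.
  by case: ns => g e; exists (g - v r); lia.
Qed.

Lemma wint0_splitting n (A : 'M[F]_n) a : wint 0 A a -> splitting A a.
Proof.
elim/ltn_ind: n A a => n IH A a hA.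
case: (pivot_or hA) => [[i [j [ij A0 vA]]]|hA2]; last by case: (wint1_splitting hA2).
case: n A a IH hA i j ij A0 vA => [|[|m]] A a IH hA i j ij A0 vA; first by case: i ij A0 vA.
  by move: ij; rewrite !ord1 eqxx.
have [s [s0 s1]] := front_perm ij.
apply: (@splitting_perm _ _ _ _ _ s).
have hA' := wint_perm s hA.
set A' := \matrix_(_, _) _ in hA' *; set a' := fun _ => _ in hA' *.
have r0 : A' (@lshift 2 m 0) (@lshift 2 m 1) != 0 by rewrite mxE s0 s1.
have vr : 2 * v (A' (@lshift 2 m 0) (@lshift 2 m 1)) =
    a' (@lshift 2 m 0) + a' (@lshift 2 m 1) + 0 by rewrite mxE /a' s0 s1.
apply: (splitting_piv hA' r0 vr); apply: IH => //.
exact: (pivA_wint Hv _ _ hA' r0 vr).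
Qed.

(* [s = Delta(B)] for [D = (-1)^[n/2] det(2B)].  For even [n] this is
   [ord D - ord disc(F(sqrt D)/F) + 1 - xi^2], the discriminant having order 0, 2, 3
   in the three cases. *)
Definition isDelta n (D : F) (s : int) : Prop :=
  D != 0 /\
  if odd n then v D = s + 1
  else [\/ Sq4 D /\ v D = s, [/\ ~ Sq4 D, evz (v D) & v D = s + 1]
         | odz (v D) /\ v D = s + 2].

(** In even rank [D] is a square modulo [2^(S + 2)], where [S] is the sum of the weights. If
    [s < S], either [D] would be a square modulo 4 or its odd order would be even. *)
Lemma Delta_ge n (A : 'M[F]_n) a s : wint 0 A a -> isDelta n (DA A) s -> \sum_i a i <= s.
Proof.
move=> /wint0_splitting; rewrite /splitting /isDelta.
set S := \sum_i a i; set D := DA A => hP [D0]; move: hP; case: ifP => _.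
  by move=> [/(hvE D0) h _]; lia.
move=> [[P [h1 h2]] _ _] h.
have hD : hv D (2 * S).
  rewrite -[D](subrK (P ^+ 2)); apply: hvD => //; first by apply: hvW h1 _; lia.
  by apply: hvW (hvX Hv 2 h2) _; lia.
have := hvE D0 hD; case: h => [[_ vD]|[ns ev vD]|[od vD]] h3; first by lia.
  case: (ltrP s S) => // l; case: ns; exists P; apply: hvW h1 _; lia.
case: (ltrP s S) => // l; exfalso.
have [] := hv_eqv Hv D0 (y := P ^+ 2); first by apply: hvW h1 _; lia.
rewrite expf_eq0 /= => P0; rewrite (vX Hv) // => e.
by apply: (evz_odzF _ od); exists (v P); lia.
Qed.

End Splitting.

(** * A criterion for the Gross-Keating invariant *)

Section Criterion.
Variables (F : fieldType) (v : F -> int).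
Hypothesis Hv : unram2adic v.
Local Notation hv := (hv v).
Local Notation Sq4 := (Sq4 v).
Local Notation wint := (wint v).
Local Notation isDelta := (isDelta v).

(** Serves both for a change of basis and for the adjunction of dual vectors, which preserves the
    parity of the rank. *)
Lemma isDelta_sq n n' D P s : odd n = odd n' -> P != 0 ->
  isDelta n D s -> isDelta n' (D * P ^+ 2) (s + 2 * v P).
Proof.
move=> on P0 [D0]; rewrite /isDelta -on mulf_neq0 ?expf_neq0 // (vM Hv) ?expf_neq0 //.
rewrite (vX Hv) //; case: (odd n) => [->|h]; split=> //; first by lia.
case: h => [[h1 h2]|[h1 [g h2] h3]|[[g h1] h2]].
- by apply: Or31; rewrite h2; split=> //; apply/Sq4_mulsq.
- apply: Or32; split; [by rewrite Sq4_mulsq|exists (g + v P); lia|lia].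
- by apply: Or33; split; [exists (g + v P); lia|lia].
Qed.

Lemma trmx_scale m n (c : F) (A : 'M[F]_(m, n)) : (c *: A)^T = c *: A^T.
Proof. by apply/matrixP => i j; rewrite !mxE. Qed.

(* Adjoining [q] vectors dual, up to the factor [t], to the last [q] basis
   vectors makes the determinant depend on the leading block only. *)
Lemma det_adjoin_dual p q (A : 'M[F]_(p + q)) (t : F) : t != 0 ->
  \det (block_mx A (t *: col_mx 0 1%:M) (t *: row_mx 0 1%:M) 0 : 'M_(p + q + q)) =
  \det (ulsubmx A) * (-1) ^+ q * t ^+ (2 * q).
Proof.
move=> t0; set M := block_mx _ _ _ _.
set E : 'M[F]_(p + q, q) := col_mx 0 1%:M.
set E' : 'M[F]_(q, p + q) := row_mx 0 1%:M.
pose Z : 'M[F]_(q, p + q) := - t^-1 *: row_mx (dlsubmx A) (drsubmx A).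
pose Z' : 'M[F]_(p + q, q) := - t^-1 *: col_mx (ursubmx A) 0.
pose T1 : 'M[F]_(p + q + q) := block_mx 1%:M 0 Z 1%:M.
pose T2 : 'M[F]_(p + q + q) := block_mx 1%:M Z' 0 1%:M.
pose S1 : 'M[F]_(p + q + q) := block_mx 1%:M E 0 1%:M.
pose S2 : 'M[F]_(p + q + q) := block_mx 1%:M (- E) 0 1%:M.
(* Adding multiples of the adjoined columns clears the last [q] rows of [A]; the adjoined rows then
   clear the rest of its last columns. *)
have e1 : M *m T1 = block_mx (block_mx (ulsubmx A) (ursubmx A) 0 0) (t *: E) (t *: E') 0.
  rewrite /M /T1 mulmx_block !mulmx1 !mul0mx !mulmx0 !add0r !addr0; congr block_mx.
  rewrite -{1}[A]submxK /Z -scalemxAl -scalemxAr scalerA mulrN divff // scaleN1r.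
  rewrite mul_col_mx mul0mx mul1mx opp_col_mx opp_row_mx oppr0.
  rewrite -[block_mx _ _ _ _]/(col_mx _ _) add_col_mx add_row_mx !subrr addr0 row_mx0.
  by rewrite /block_mx row_mx0.
have e2 : T2 *m (M *m T1) = block_mx (block_mx (ulsubmx A) 0 0 0) (t *: E) (t *: E') 0.
  rewrite e1 /T2 mulmx_block !mul1mx !mul0mx !mulmx0 !add0r !addr0; congr block_mx.
  rewrite /Z' -scalemxAl -scalemxAr scalerA mulNr mulVf // scaleN1r.
  rewrite mul_col_row mulmx0 mulmx1 !mul0mx opp_block_mx add_block_mx.
  by rewrite !oppr0 !addr0 subrr.
(* What remains besides [ulsubmx A] are [q] hyperbolic planes, made triangular with diagonal entries
   [t] and [- t]. *)
have e3 : S1 *m (T2 *m (M *m T1)) *m S2 =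
    block_mx (block_mx (ulsubmx A) 0 0 t%:M) 0 (t *: E') (- t%:M).
  rewrite e2 /S1 /S2 !mulmx_block !mul1mx !mul0mx !mulmx0 !add0r !addr0 !mulmx1.
  have eE : E *m E' = block_mx 0 0 0 1%:M by rewrite mul_col_row !mulmx0 !mulmx1 ?mul0mx.
  have eE' : E' *m E = 1%:M by rewrite mul_row_col mulmx0 mulmx1 add0r.
  rewrite -scalemxAr eE; congr block_mx.
  - rewrite scale_block_mx add_block_mx !scaler0 !addr0 add0r.
    by rewrite scalemx1.
  - rewrite scale_block_mx add_block_mx !scaler0 !addr0 add0r scalemx1.
    rewrite mulmxN mul_block_col !mulmx0 !mulmx1 ?add0r ?addr0.
    by rewrite scale_col_mx scaler0 scalemx1 addrC subrr.
  - by rewrite addr0 mulmxN -scalemxAl eE' scalemx1.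
have := congr1 determinant e3; rewrite !det_mulmx /S1 /S2 /T2 /T1 !det_ublock !det_lblock.
rewrite !det1 !mul1r !mulr1 => ->.
rewrite -scaleN1r detZ !det_scalar exprM expr2 exprMn -!mulrA; congr (_ * _).
by rewrite mulrCA.
Qed.

(** Adjoin [q] vectors of weight [m], dual to the last basis vectors up to [2^m]; [b j <= m] keeps
    the weights admissible. The enlarged lattice has Delta equal to [s + 2 q m] and weights of sum
    [\sum_j b j + q m], so [Delta_ge] gives the claim. *)
Lemma ext_bound p q (M U : 'M[F]_(p + q)) (b : 'I_(p + q) -> int) (m : nat) s :
  M^T = M -> in_GLo v U -> (forall j, b j <= m%:Z) -> wint 0 (2 *: (U^T *m M *m U)) b ->
  isDelta p (DA (2 *: ulsubmx M)) s -> \sum_j b j <= s + (q * m)%N%:Z.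
Proof.
move=> sM [iU [U0 vU]] bm hS hD.
pose t : F := 2 ^+ m; have t0 : t != 0 := pow2_neq0 Hv m.
pose E : 'M[F]_(p + q, q) := t *: col_mx 0 1%:M.
pose E' : 'M[F]_(q, p + q) := t *: row_mx 0 1%:M.
have tE : E^T = E' by rewrite trmx_scale tr_col_mx trmx0 trmx1.
pose A : 'M[F]_(p + q + q) := block_mx (2 *: (U^T *m M *m U)) (U^T *m E) (E' *m U) 0.
pose bb (i : 'I_(p + q + q)) : int := match split i with inl j => b j | inr _ => m%:Z end.
have bl j : bb (lshift q j) = b j by rewrite /bb -[lshift q j]/(unsplit (inl j)) unsplitK.
have br j : bb (rshift _ j) = m%:Z by rewrite /bb -[rshift _ j]/(unsplit (inr j)) unsplitK.
have hE i k : hv (E i k) (2 * m%:Z).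
  rewrite mxE; have -> : 2 * m%:Z = 2 * m%:Z + 0 by rewrite addr0.
  apply: hvM => //; first by right; rewrite (v_pow2 Hv).
  rewrite mxE; case: split => x; rewrite mxE; first by left.
  by case: eqP => _; [right; rewrite (v1 Hv)|left].
have hUE i k : hv ((U^T *m E) i k) (b i + m%:Z).
  rewrite mxE; apply: hv_sum => // l _; rewrite mxE.
  have /hv_o hU := iU l i.
  by apply: hvW (hvM Hv hU (hE l k)) _; have := bm i; lia.
have symA : A^T = A.
  rewrite /A tr_block_mx trmx0 !trmx_mul trmxK tE; congr block_mx.
    by case: hS.
  by rewrite -tE trmxK.
have hA : wint 0 A bb.
  have [_ hd ho] := hS; split=> //.
    move=> i; case: (split_ordP i) => j ->; rewrite ?bl ?br; first by rewrite block_mxEul; apply: hd.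
    by rewrite block_mxEdr mxE; left.
  move=> i j; case: (split_ordP i) => i' ->; case: (split_ordP j) => j' ->; rewrite ?bl ?br => ij.
  - by rewrite block_mxEul; apply: ho; rewrite (inj_eq (@lshift_inj _ _)) in ij.
  - by rewrite block_mxEur addr0; apply: hUE.
  - by rewrite -symA mxE block_mxEur addr0 addrC; apply: hUE.
  - by rewrite block_mxEdr mxE; left.
have eD : DA A = DA (2 *: ulsubmx M) * (t ^+ q * \det U) ^+ 2.
  pose V : 'M[F]_(p + q + q) := block_mx U 0 0 1%:M.
  have e : A = V^T *m block_mx (2 *: M) E E' 0 *m V.
    rewrite /V tr_block_mx !trmx0 trmx1 !mulmx_block !mul0mx !mulmx0 !mul1mx !mulmx1.
    by rewrite !addr0 !add0r -scalemxAr -scalemxAl.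
  rewrite /DA e !det_mulmx det_tr /V det_ublock det1 mulr1 det_adjoin_dual //.
  have -> : ulsubmx (2 *: M) = 2 *: ulsubmx M by apply/matrixP => i j; rewrite !mxE.
  have -> : ((p + q + q)./2 = p./2 + q)%N by lia.
  rewrite exprD mulnC exprM exprMn.
  have sg : ((-1) ^+ q * (-1) ^+ q : F) = 1 by rewrite -expr2 sqrr_sign.
  set ee : F := (-1) ^+ q in sg *; set x : F := (-1) ^+ p./2.
  set y := \det (_ *: ulsubmx M); set z := \det U; set w := t ^+ q.
  transitivity (x * y * (w ^+ 2 * z ^+ 2) * (ee * ee)); first by ring.
  by rewrite sg mulr1.
have P0 : t ^+ q * \det U != 0 by apply: mulf_neq0 => //; apply: expf_neq0.
have vP : v (t ^+ q * \det U) = (q * m)%N%:Z.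
  by rewrite (vM Hv (expf_neq0 q t0) U0) vU addr0 /t -exprM (v_pow2 Hv) mulnC.
have oN : odd p = odd (p + q + q) by lia.
have := isDelta_sq oN P0 hD; rewrite -eD => /(Delta_ge Hv hA).
have -> : \sum_i bb i = \sum_j b j + (q * m)%N%:Z.
  rewrite big_split_ord /=; congr (_ + _); first by apply: eq_bigr => j _; rewrite bl.
  under eq_bigr => j _ do rewrite br.
  by rewrite sumr_const card_ord -mulr_natr natz; lia.
by rewrite vP; lia.
Qed.

(** Entries indexed by [nat], with default 0, so that leading blocks of any size need no casts. *)
Definition ent n (M : 'M[F]_n) (i j : nat) : F :=
  match insub i, insub j with Some i', Some j' => M i' j' | _, _ => 0 end.

Lemma entE n (M : 'M[F]_n) (i j : 'I_n) : ent M i j = M i j.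
Proof. by rewrite /ent !valK. Qed.

Lemma mxn_ent n (M : 'M[F]_n) : mxn n (ent M) = M.
Proof. by apply/matrixP => i j; rewrite mxE entE. Qed.

Definition good n (M : 'M[F]_n) (a : nat -> nat) : Prop :=
  [/\ M^T = M, in_S v M (fun i => a i) &
    forall p, (p <= n)%N -> p = n \/ (0 < p)%N /\ (a p.-1 < a p)%N ->
      isDelta p (DA (2 *: mxn p (ent M))) (\sum_(j < p) (a j)%:Z)].

Lemma in_S_wint n (M : 'M[F]_n) (a : 'I_n -> nat) : M^T = M -> in_S v M a ->
  wint 0 (2 *: M) (fun i => (a i)%:Z).
Proof.
move=> sM [_ [hd ho]]; split; first by rewrite trmx_scale sM.
  move=> i; rewrite mxE; have h2 : hv 2 2 by right; rewrite (u2_two Hv).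
  by have /hv_ge h := hd i; apply: hvW (hvM Hv h2 h) _; lia.
move=> i j _; rewrite mxE addr0.
case: (leqP i j) => ij; first by apply: hvW (ho i j ij) _; lia.
by rewrite -sM mxE; apply: hvW (ho j i (ltnW ij)) _; lia.
Qed.

Lemma good_GK n (M : 'M[F]_n) (a : nat -> nat) : good M a -> is_GK v M (fun i => a i).
Proof.
move=> [sM hS hD]; split.
  exists 1%:M; rewrite trmx1 mul1mx mulmx1; split=> //; split.
    move=> i j; rewrite mxE; apply/hv_o; case: eqP => _; [right|left] => //.
    by rewrite (v1 Hv).
  by rewrite det1; split; [apply: oner_neq0|apply: (v1 Hv)].
move=> U a' hU hS'.
case: (classic (a' =1 (fun i : 'I_n => a i))) => [e|ne]; first by left.
have /existsP [x hx] : [exists i, a' i != a i].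
  by apply: contraT => /existsPn h; case: ne => i; apply/eqP; have := h i; rewrite negbK.
case: (arg_minnP (fun i : 'I_n => nat_of_ord i) (P := fun i => a' i != a i) hx) => i hi imin.
have ieq (j : 'I_n) : (j < i)%N -> a' j = a j.
  by move=> ji; apply/eqP; apply: contraLR ji => h; rewrite -leqNgt; apply: imin.
right; exists i; split; last exact: ieq.
case: (ltngtP (a' i) (a i)) => [//|lt|e]; last by rewrite e eqxx in hi.
exfalso.
have [sa _] := hS; have [sa' _] := hS'.
(* [p] will be the first position after [i] at which the weights [a] jump, or [n]. *)
have exp : exists p, (i < p)%N && ((p == n) || (a i < a p)%N).
  by exists n; rewrite eqxx ltn_ord.
case: (ex_minnP exp) => p /andP [ip hp] pmin.
have pn : (p <= n)%N by apply: pmin; rewrite eqxx ltn_ord.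
have ac j : (i <= j)%N -> (j < p)%N -> a j = a i.
  move=> ij jp; have jn : (j < n)%N by lia.
  apply/eqP; rewrite eqn_leq (sa i (Ordinal jn)) // andbT.
  move: ij; rewrite leq_eqVlt => /orP [/eqP <-//|ij].
  by rewrite leqNgt; apply/negP => h; have := pmin j; rewrite ij h orbT => /(_ isT); lia.
have jmp : p = n \/ (0 < p)%N /\ (a p.-1 < a p)%N.
  case/orP: hp => [/eqP|h]; [by left|right].
  by rewrite (ac p.-1); lia.
have hdp := hD p pn jmp.
move: {hD hp exp pmin} hdp.
have [q eq] : exists q, n = (p + q)%N by exists (n - p)%N; lia.
subst n => hdp.
have eul : mxn p (ent M) = ulsubmx M.
  by apply/matrixP => k l; rewrite !mxE -[LHS]/(ent M (lshift q k) (lshift q l)) entE.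
rewrite eul in hdp.
(* This is [min(a', a i + 1)] for [j < i], and [a' j] is at least [a i + 1] afterwards. *)
pose b (j : 'I_(p + q)) : int := if (j < i)%N then (a j)%:Z else (a i).+1%:Z.
have ba j : b j <= (a' j)%:Z.
  rewrite /b; case: ltnP => ji; first by rewrite ieq.
  by have := sa' i j ji; lia.
have bm j : b j <= (a i).+1%:Z.
  by rewrite /b; case: ltnP => // ji; have := sa j i (ltnW ji); lia.
have sMU : (U^T *m M *m U)^T = U^T *m M *m U by rewrite !trmx_mul trmxK sM mulmxA.
have hw : wint 0 (2 *: (U^T *m M *m U)) b.
  have [h1 h2 h3] := in_S_wint sMU hS'; split=> // [k|k l kl].
    by apply: hvW (h2 k) _; have := ba k; lia.
  by apply: hvW (h3 k l kl) _; have := ba k; have := ba l; lia.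
have := ext_bound sM hU bm hw hdp.
rewrite big_split_ord /=.
have -> : \sum_(k < q) b (rshift p k) = (q * (a i).+1)%N%:Z.
  have eb k : b (rshift p k) = (a i).+1%:Z by rewrite /b ltnNge /= (leq_trans (ltnW ip)) ?leq_addr.
  under eq_bigr => k _ do rewrite eb.
  by rewrite sumr_const card_ord -mulr_natr natz; lia.
(* The last [q] weights cancel; on the first [p] positions [b] dominates [a], strictly at [i]. *)
rewrite lerD2r; apply/negP; rewrite -ltNge.
pose i' : 'I_p := Ordinal ip.
rewrite (bigD1 i') //= [ltRHS](bigD1 i') //=; apply: ltr_leD.
  by rewrite /b /= ltnn; lia.
apply: ler_sum => k _; rewrite /b /=; case: ltnP => // ik.
by rewrite (ac k) //; lia.
Qed.

End Criterion.

(** * Appending a block *)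

Section Step.
Variables (F : fieldType) (v : F -> int).
Hypothesis Hv : unram2adic v.
Local Notation hv := (hv v).
Local Notation Sq4 := (Sq4 v).
Local Notation wint := (wint v).
Local Notation isDelta := (isDelta v).
Local Notation open_vec := (open_vec v).
Local Notation good := (good v).

Definition good_basis d (B : 'M[F]_d) (a : nat -> nat) (U : 'M[F]_d) : Prop :=
  in_GLo v U /\ good (U^T *m B *m U) a.

Definition aext d (a : nat -> nat) c j := if (j < d)%N then a j else c.

Lemma ent_block d e (X : 'M[F]_d) (Y : 'M_(d, e)) (Z : 'M_(e, d)) (T : 'M_e) i j :
  (i < d)%N -> (j < d)%N -> ent (block_mx X Y Z T) i j = ent X i j.
Proof.
move=> hi hj; rewrite -[i]/(nat_of_ord (lshift e (Ordinal hi))).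
rewrite -[j in LHS]/(nat_of_ord (lshift e (Ordinal hj))) entE block_mxEul.
by rewrite -[RHS]/(ent X (Ordinal hi) (Ordinal hj)) entE.
Qed.

Lemma lead_block d e (X : 'M[F]_d) (Y : 'M_(d, e)) (Z : 'M_(e, d)) (T : 'M_e) p :
  (p <= d)%N -> mxn p (ent (block_mx X Y Z T)) = mxn p (ent X).
Proof.
move=> pd; apply/matrixP => i j; rewrite !mxE ent_block //.
  exact: leq_trans (ltn_ord i) pd.
exact: leq_trans (ltn_ord j) pd.
Qed.

Lemma DA_congr n (M U : 'M[F]_n) : DA (2 *: (U^T *m M *m U)) = DA (2 *: M) * \det U ^+ 2.
Proof.
rewrite /DA !detZ !det_mulmx det_tr; ring.
Qed.

Lemma congr_block d e (B : 'M[F]_d) (C : 'M_e) U (w : 'M_(d, e)) :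
  let M := U^T *m B *m U in
  (block_mx U (U *m w) 0 1%:M)^T *m block_mx B 0 0 C *m block_mx U (U *m w) 0 1%:M =
  block_mx M (M *m w) (w^T *m M) (C + w^T *m M *m w).
Proof.
move=> M; rewrite tr_block_mx trmx0 trmx1 !mulmx_block !mulmx0 !mul0mx !mul1mx !mulmx1.
by rewrite !addr0 !add0r trmx_mul /M !mulmxA [C + _]addrC.
Qed.

(** The columns of [w] correct the new basis vectors by elements of the old lattice. Only the Delta
    of the whole is to be supplied; that of the leading blocks is inherited. *)
Lemma step d e (B : 'M[F]_d) (C : 'M_e) U a (w : 'M_(d, e)) (c : nat) :
  let M := U^T *m B *m U in
  C^T = C -> good_basis B a U -> (forall i j, hv (w i j) 0) ->
  (forall i, (i < d)%N -> (a i <= c)%N) ->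
  (forall (i : 'I_d) j, hv ((2 *: M *m w) i j) ((a i)%:Z + c%:Z)) ->
  (forall j, hv ((C + w^T *m M *m w) j j) (2 * c%:Z)) ->
  (forall i j, i != j -> hv (2 * (C + w^T *m M *m w) i j) (2 * c%:Z)) ->
  isDelta (d + e) (DA (2 *: block_mx B 0 0 C)) (\sum_(j < d) (a j)%:Z + (e * c)%N%:Z) ->
  good_basis (block_mx B 0 0 C) (aext d a c) (block_mx U (U *m w) 0 1%:M).
Proof.
move=> M sC [[iU [U0 vU]] [sM [sa [hd ho]] hD]] iw ac hc hCd hCo hDel.
set U' := block_mx U _ _ _.
have detU' : \det U' = \det U by rewrite det_ublock det1 mulr1.
split.
  split; last by rewrite detU'.
  move=> i j; apply/hv_o; case: (split_ordP i) => i' ->; case: (split_ordP j) => j' ->.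
  - by rewrite block_mxEul; apply/hv_o.
  - rewrite block_mxEur mxE; apply: hv_sum => // l _; rewrite -[0]addr0.
    by apply: hvM => //; apply/hv_o.
  - by rewrite block_mxEdl mxE; left.
  - rewrite block_mxEdr mxE; case: eqP => _; last by left.
    by right; rewrite (v1 Hv).
set M' := U'^T *m _ *m U'.
have eM' : M' = block_mx M (M *m w) (w^T *m M) (C + w^T *m M *m w) by apply: congr_block.
have sM' : M'^T = M'.
  have tM : M^T = M := sM.
  rewrite eM' tr_block_mx !linearD /= (trmx_mul M w) (trmx_mul w^T M).
  by rewrite (trmx_mul (w^T *m M) w) (trmx_mul w^T M) trmxK sC tM mulmxA.
have al (i : 'I_d) : aext d a c (lshift e i) = a i by rewrite /aext /= ltn_ord.
have ar (i : 'I_e) : aext d a c (rshift d i) = c by rewrite /aext /= ltnNge leq_addr.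
split=> //.
  split; [|split].
  - move=> i j; case: (split_ordP i) => i' ->; case: (split_ordP j) => j' -> /= ij;
      rewrite ?(al, ar) //; first exact: sa.
      exact: ac.
    by move: ij; have := ltn_ord j'; lia.
  - move=> i; case: (split_ordP i) => i' ->; rewrite eM' ?al ?ar.
      by rewrite block_mxEul; apply: hd.
    by rewrite block_mxEdr; apply/hv_ge; apply: hCd.
  - suff H (i j : 'I_(d + e)) : (i <= j)%N -> hv (2 * M' i j) ((aext d a c i)%:Z + (aext d a c j)%:Z).
      by move=> i j ij; case: (H i j ij) => h; [left|right; rewrite PoszD].
    case: (split_ordP i) => i' ->; case: (split_ordP j) => j' -> /= ij;
      rewrite eM' ?al ?ar.
    + by rewrite block_mxEul; apply: hvW (ho i' j' ij) _; lia.
    + rewrite block_mxEur; have := hc i' j'; by rewrite -scalemxAl mxE.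
    + by move: ij; have := ltn_ord j'; lia.
    + rewrite block_mxEdr; have [->|ne] := eqVneq i' j'; last first.
        by apply: hvW (hCo _ _ ne) _; lia.
      have h2 : hv 2 2 by right; rewrite (u2_two Hv).
      by apply: hvW (hvM Hv h2 (hCd j')) _; lia.
move=> p; rewrite leq_eqVlt => /orP [/eqP -> _|pd hj].
  rewrite mxn_ent DA_congr detU'.
  have -> : \sum_(j < d + e) (aext d a c j)%:Z =
      \sum_(j < d) (a j)%:Z + (e * c)%N%:Z + 2 * v (\det U).
    rewrite vU addr0 big_split_ord /=; congr (_ + _).
      by apply: eq_bigr => j _; rewrite -[X in aext _ _ _ X]/(nat_of_ord (lshift e j)) al.
    rewrite (eq_bigr (fun=> c%:Z)) => [|j _]; last first.
      by rewrite -[X in aext _ _ _ X]/(nat_of_ord (rshift d j)) ar.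
    by rewrite sumr_const card_ord -mulr_natr natz; lia.
  exact: isDelta_sq.
(* The appended weights are constant, so a jump can only occur at [p <= d]. *)
have pd' : (p <= d)%N.
  case: hj => [e'|[p0]]; first by lia.
  move=> h; rewrite leqNgt; apply/negP => dp; move: h.
  have e1 : (p.-1 < d)%N = false by lia.
  have e2 : (p < d)%N = false by lia.
  by rewrite /aext e1 e2 ltnn.
rewrite eM' lead_block //.
have -> : \sum_(j < p) (aext d a c j)%:Z = \sum_(j < p) (a j)%:Z.
  by apply: eq_bigr => j _; rewrite /aext (leq_trans (ltn_ord j) pd').
apply: hD => //; move: pd'; rewrite leq_eqVlt => /orP [/eqP|pd']; [by left|right].
case: hj => [e'|[p0]]; first by lia.
by rewrite /aext pd' (leq_ltn_trans (leq_pred p) pd').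
Qed.

Lemma residue_sqrt t : hv t 0 -> exists2 s, hv s 0 & hv (t - s ^+ 2) 2.
Proof.
move=> ht; case: (classic (hv t 2)) => [h|h].
  by exists 0; [left|rewrite expr0n subr0].
have t0 : t != 0 by apply/negP => /eqP e; apply: h; left.
have vt : v t = 0.
  have := hvE t0 ht; case: (ltrP 0 (v t)) => // l; last by lia.
  by case: h; right; lia.
have [s [s0 vs] hs] := residue_perfect Hv (conj t0 vt).
by exists s => //; right; lia.
Qed.

(** * Correcting a new vector by open vectors *)

Section Raise.
Variables (d : nat) (A : 'M[F]_d) (a : nat -> nat).
Local Notation aZ := (fun i : 'I_d => (a i)%:Z).
Hypothesis sA : A^T = A.

Definition bf (x y : 'cV[F]_d) : F := (x^T *m (A *m y)) 0 0.

Lemma bfE x y : bf x y = \sum_i x i 0 * (A *m y) i 0.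
Proof. by rewrite /bf mxE; apply: eq_bigr => i _; rewrite mxE. Qed.

Lemma bfC x y : bf x y = bf y x.
Proof.
rewrite /bf.
have -> : x^T *m (A *m y) = (y^T *m (A *m x))^T by rewrite !trmx_mul trmxK sA mulmxA.
by rewrite mxE.
Qed.

Lemma qfZ s x : qf A (s *: x) = s ^+ 2 * qf A x.
Proof.
rewrite /qf trmx_scale -scalemxAr -scalemxAl -scalemxAr scalerA mxE; ring.
Qed.

Lemma qfD x y : qf A (x + y) = qf A x + qf A y + 2 * bf x y.
Proof.
have : qf A (x + y) = qf A x + bf x y + (bf y x + qf A y).
  by rewrite /qf /bf linearD /= mulmxDr !mulmxDl !mulmxDr !mxE.
by rewrite (bfC y x) => ->; ring.
Qed.

(* Adding [x] to a new vector of value [u] and level [k], orthogonal to the old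
   lattice, makes [cc] an admissible weight for it. *)
Definition raise (k : int) (u : F) (cc : int) (x : 'cV[F]_d) : Prop :=
  [/\ forall i, hv (x i 0) (k - aZ i), forall i, hv ((A *m x) i 0) (aZ i + cc) &
      hv (u + qf A x / 2) (2 * cc)].

Lemma raise0 k u : hv u (2 * k) -> raise k u k 0.
Proof.
move=> hu; split.
- by move=> i; rewrite mxE; left.
- by move=> i; rewrite mulmx0 mxE; left.
- by rewrite /qf trmx0 mul0mx mxE mul0r addr0.
Qed.

Lemma open_vec_half k h c : open_vec A aZ k h c -> qf A c / 2 != 0 /\ v (qf A c / 2) = k.
Proof.
move=> [_ q0 vq _]; have t0 := two_neq0 Hv.
split; first by rewrite mulf_neq0 ?invr_eq0.
by rewrite (vM Hv) ?invr_eq0 // (vV Hv) // vq (u2_two Hv); lia.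
Qed.

(** The residue field is perfect: with [s ^+ 2] congruent to [- u / q] modulo 2, adding [s *: c]
    cancels the leading term of [u]. *)
Lemma raise1 k u c : hv u (2 * k) -> open_vec A aZ k 1 c ->
  exists x, raise k u (k + 1) x.
Proof.
move=> hu o; have [q0 vq] := open_vec_half o; have [c1 _ _ c4] := o.
set q := qf A c / 2 in q0 vq.
have hr : hv (- u / q) 0 by apply: hvW (hv_div Hv q0 (hvN Hv hu)) _; lia.
have [s s1 s2] := residue_sqrt hr.
exists (s *: c); split.
- by move=> i; rewrite mxE; apply: hvW (hvM Hv s1 (c1 i)) _; lia.
- by move=> i; rewrite -scalemxAr mxE; apply: hvW (hvM Hv s1 (c4 i)) _; lia.
- rewrite qfZ; have -> : u + s ^+ 2 * qf A c / 2 = - (q * (- u / q - s ^+ 2)).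
    by rewrite /q; field; move: q0; rewrite /q mulf_eq0 invr_eq0 negb_or => /andP [-> ->].
  by apply: hvN => //; apply: hvW (hvM Hv (hvv v q) s2) _; lia.
Qed.

(** With [P ^+ 2] approximating [- u * q] modulo 4, the multiple [P / q] of a single open vector
    gains two levels at once. *)
Lemma raise2_one k u c : open_vec A aZ k 2 c -> u != 0 -> v u = k ->
  Sq4 (- u * (qf A c / 2)) -> exists x, raise k u (k + 2) x.
Proof.
move=> o u0 vu; have [q0 vq] := open_vec_half o; have [c1 _ _ c4] := o.
set q := qf A c / 2 in q0 vq * => sq.
have D0 : - u * q != 0 by rewrite mulf_neq0 ?oppr_eq0.
have [P [P0 vP hP]] := Sq4_root Hv D0 sq.
have vD : v (- u * q) = 2 * k by rewrite (vM Hv) ?oppr_eq0 // (vN Hv); lia.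
have hs : hv (P / q) 0 by apply: hvW (hv_div Hv q0 (hvv v P)) _; lia.
exists ((P / q) *: c); split.
- by move=> i; rewrite mxE; apply: hvW (hvM Hv hs (c1 i)) _; lia.
- by move=> i; rewrite -scalemxAr mxE; apply: hvW (hvM Hv hs (c4 i)) _; lia.
- rewrite qfZ; have -> : u + (P / q) ^+ 2 * qf A c / 2 = - ((- u * q - P ^+ 2) / q).
    have -> : qf A c = 2 * q by rewrite /q; field; apply: (two_neq0 Hv).
    by field; rewrite q0 (two_neq0 Hv).
  by apply: hvN => //; apply: hvW (hv_div Hv q0 hP) _; lia.
Qed.

(** Two successive residual square roots: [c] cancels the term of level [k], then [c'] the remainder
    of level [k + 1]. *)
Lemma raise2_two k u c c' : hv u (2 * k) -> open_vec A aZ k 2 c -> open_vec A aZ (k + 1) 2 c' ->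
  exists x, raise k u (k + 2) x.
Proof.
move=> hu o o'; have [q0 vq] := open_vec_half o; have [c1 _ _ c4] := o.
have [q0' vq'] := open_vec_half o'; have [c1' _ _ c4'] := o'.
set q := qf A c / 2 in q0 vq; set q' := qf A c' / 2 in q0' vq'.
have hr : hv (- u / q) 0 by apply: hvW (hv_div Hv q0 (hvN Hv hu)) _; lia.
have [s s1 s2] := residue_sqrt hr.
pose y := - (q * (- u / q - s ^+ 2)).
have hy : hv y (2 * (k + 1)) by apply: hvN => //; apply: hvW (hvM Hv (hvv v q) s2) _; lia.
have hr' : hv (- y / q') 0 by apply: hvW (hv_div Hv q0' (hvN Hv hy)) _; lia.
have [s' s1' s2'] := residue_sqrt hr'.
(* The weights give the doubled bound [2 k + 3], which integrality rounds up to [2 k + 4]. *)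
have hb : hv (bf c c') (2 * (k + 2)).
  apply: hv_round; rewrite bfE; apply: hv_sum => // i _.
  by apply: hvW (hvM Hv (c1 i) (c4' i)) _; lia.
exists (s *: c + s' *: c'); split.
- move=> i; rewrite !mxE; apply: hvD => //; first by apply: hvW (hvM Hv s1 (c1 i)) _; lia.
  by apply: hvW (hvM Hv s1' (c1' i)) _; lia.
- move=> i; rewrite mulmxDr -!scalemxAr !mxE; apply: hvD => //.
    by have := c4 i; rewrite mxE => h; apply: hvW (hvM Hv s1 h) _; lia.
  by have := c4' i; rewrite mxE => h; apply: hvW (hvM Hv s1' h) _; lia.
- have e : bf (s *: c) (s' *: c') = s * s' * bf c c'.
    by rewrite /bf trmx_scale -!scalemxAr -scalemxAl scalerA mxE mulrC; ring.
  have e1 : qf A c = 2 * q by rewrite /q; field; apply: (two_neq0 Hv).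
  have e2 : qf A c' = 2 * q' by rewrite /q'; field; apply: (two_neq0 Hv).
  have -> : u + qf A (s *: c + s' *: c') / 2 = - (q' * (- y / q' - s' ^+ 2)) + s * s' * bf c c'.
    rewrite qfD !qfZ e e1 e2 /y; field; by rewrite (two_neq0 Hv) q0 q0'.
  apply: hvD => //.
    by apply: hvN => //; apply: hvW (hvM Hv (hvv v q') s2') _; lia.
  by apply: hvW (hvM Hv (hvM Hv s1 s1') hb) _; lia.
Qed.

Lemma opnZ k h c (l : int) : open_vec A aZ k h c -> open_vec A aZ (k + 2 * l) h ((2 ^ l) *: c).
Proof.
move=> [c1 c2 c3 c4]; have p0 := pow2z_neq0 Hv l; have vp := v_pow2z Hv l.
have hp : hv (2 ^ l) (2 * l) by right; rewrite vp.
split.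
- by move=> j; rewrite mxE; apply: hvW (hvM Hv hp (c1 j)) _; lia.
- by rewrite qfZ mulf_neq0 ?expf_neq0.
- by rewrite qfZ (vM Hv) ?expf_neq0 // (vX Hv) // vp c3; lia.
- by move=> j; rewrite -scalemxAr mxE; apply: hvW (hvM Hv hp (c4 j)) _; lia.
Qed.

Lemma open_vec_le k h h' c : h' <= h -> open_vec A aZ k h c -> open_vec A aZ k h' c.
Proof.
by move=> hh [c1 c2 c3 c4]; split=> // j; apply: hvW (c4 j) _; lia.
Qed.

Lemma open_pair_all h k : open_pair v A aZ h -> exists c, open_vec A aZ k h c.
Proof.
move=> [k1 [c1 [k2 [c2 [[g od] o1 o2]]]]].
case: (evz_or_odz (k - k1)) => [[l e]|[l e]].
  by exists (2 ^ l *: c1); have -> : k = k1 + 2 * l by [lia]; apply: opnZ.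
exists (2 ^ (l + k1 - g) *: c2).
by have -> : k = k2 + 2 * (l + k1 - g) by [lia]; apply: opnZ.
Qed.

Lemma open_even k : wint 0 A aZ -> ~~ odd d ->
  isDelta d (DA A) (\sum_(j < d) (a j)%:Z) -> ~ Sq4 (DA A) ->
  (exists c, open_vec A aZ k 1 c) /\ (odz (v (DA A)) -> exists c, open_vec A aZ k 2 c).
Proof.
move=> hA ev; rewrite /isDelta (negPf ev) => -[D0 hD] ns.
have := wint0_splitting Hv hA; rewrite /splitting (negPf ev) => -[_ h1 h2].
case: hD => [[//]|[_ e vD]|[od vD]].
  split; first by apply: open_pair_all; apply: h1.
  by move=> od; case: (evz_odzF e od).
have [c o] := open_pair_all k (h2 D0 vD od).
by split=> [|_]; exists c => //; apply: open_vec_le o.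
Qed.

(** In odd rank [v D] equals the level plus 1 plus an even number, so the level of an open vector
    has a prescribed parity; scaling reaches all levels of that parity. *)
Lemma open_odd k : wint 0 A aZ -> odd d ->
  isDelta d (DA A) (\sum_(j < d) (a j)%:Z) -> odz (v (DA A) - k) ->
  exists c, open_vec A aZ k 2 c /\ exists2 P, P != 0 & hv (DA A - qf A c * P ^+ 2) (2 * v (DA A) + 4).
Proof.
move=> hA od; rewrite /isDelta od => -[D0 hD] [g eg].
have := wint0_splitting Hv hA; rewrite /splitting od => -[_ h1].
have [k1 [c [o [P hP]]]] := h1 D0 hD.
have [_ q0 vq _] := o.
have [] := hv_eqv Hv D0 (y := qf A c * P ^+ 2); first by apply: hvW hP _; lia.
rewrite mulf_eq0 expf_eq0 /= negb_or => /andP [_ P0].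
rewrite (vM Hv) ?expf_neq0 // (vX Hv) // => e.
pose l := v P - g.
exists (2 ^ l *: c); split.
  by have -> : k = k1 + 2 * l by [rewrite /l; lia]; apply: opnZ.
exists (P / 2 ^ l); first by rewrite mulf_neq0 ?invr_eq0 ?(pow2z_neq0 Hv).
have -> : qf A (2 ^ l *: c) * (P / 2 ^ l) ^+ 2 = qf A c * P ^+ 2.
  by rewrite qfZ; field; rewrite (pow2z_neq0 Hv).
by [].
Qed.

End Raise.

End Step.

(** * Weights of an appended block *)

Section Blocks.
Variables (F : fieldType) (v : F -> int).
Hypothesis Hv : unram2adic v.
Local Notation hv := (hv v).
Local Notation Sq4 := (Sq4 v).
Local Notation wint := (wint v).
Local Notation isDelta := (isDelta v).
Local Notation open_vec := (open_vec v).
Local Notation good_basis := (good_basis v).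
Local Notation raise := (raise v).

Lemma Sq4_close W T : W != 0 -> Sq4 W -> hv (W - T) (2 * v W + 4) -> Sq4 T.
Proof.
move=> W0 [R hR] h1.
have [T0 vT] : T != 0 /\ v T = v W by apply: hv_eqv => //; apply: hvW h1 _; lia.
exists R; rewrite vT.
have -> : T - R ^+ 2 = (W - R ^+ 2) - (W - T) by ring.
exact: hvB.
Qed.

Definition D2 n (B : 'M[F]_n) : F := DA (2 *: B).

Lemma D2_block1 d (B : 'M[F]_d) (c : F) :
  D2 (block_mx B 0 0 (c%:M : 'M_1)) = (if odd d then -1 else 1) * (D2 B * (2 * c)).
Proof.
rewrite /D2 /DA scale_block_mx !scaler0 det_ublock scale_scalar_mx det_scalar1.
case: ifP => od.
  have -> : ((d + 1)./2 = d./2.+1)%N by lia.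
  rewrite exprS; ring.
have -> : ((d + 1)./2 = d./2)%N by lia.
ring.
Qed.

Lemma D2_block2 d (B : 'M[F]_d) (C : 'M_2) : D2 (block_mx B 0 0 C) = D2 B * D2 C.
Proof.
rewrite /D2 /DA scale_block_mx !scaler0 det_ublock.
have -> : ((d + 2)./2 = d./2 + 1)%N by lia.
rewrite exprD; ring.
Qed.

Definition diag2 (c1 c2 : F) : 'M[F]_2 :=
  \matrix_(i, j) if i == j then (if i == 0 then c1 else c2) else 0.

Lemma D2_diag2 c1 c2 : D2 (diag2 c1 c2) = - (4 * (c1 * c2)).
Proof.
rewrite /D2 /DA det2 !mxE /= expr1.
have -> : (4 : F) = 2 * 2 by rewrite -natrM.
ring.
Qed.

Lemma good_basis_Delta d (B : 'M[F]_d) a U : good_basis B a U ->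
  isDelta d (D2 B) (\sum_(j < d) (a j)%:Z).
Proof.
move=> [[_ [U0 vU]] [_ _ /(_ d (leqnn d) (or_introl erefl))]].
rewrite mxn_ent DA_congr => h.
have V0 : (\det U)^-1 != 0 by rewrite invr_eq0.
have := isDelta_sq Hv (erefl (odd d)) V0 h.
by rewrite (vV Hv) // vU oppr0 mulr0 addr0 exprVn mulfK ?expf_neq0.
Qed.

Section OneBasis.
Variables (d : nat) (B : 'M[F]_d) (a : nat -> nat) (U : 'M[F]_d).
Hypothesis g : good_basis B a U.
Let M := U^T *m B *m U.
Let A := 2 *: M.
Let S : int := \sum_(j < d) (a j)%:Z.
Let D := D2 B.

Let sM : M^T = M. Proof. by have [_ [h _ _]] := g. Qed.
Let sA : A^T = A. Proof. by rewrite trmx_scale sM. Qed.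
Let hA : wint 0 A (fun i : 'I_d => (a i)%:Z).
Proof. by apply: in_S_wint => //; have [_ [_ h _]] := g. Qed.
Let hDl : isDelta d D S. Proof. exact: (good_basis_Delta g). Qed.
Let D0 : D != 0. Proof. by case: hDl. Qed.
Let U0 : \det U != 0. Proof. by have [[_ [h _]] _] := g. Qed.
Let vU : v (\det U) = 0. Proof. by have [[_ [_ h]] _] := g. Qed.
Let DAA : DA A = D * \det U ^+ 2. Proof. exact: DA_congr. Qed.
Let vDAA : v (DA A) = v D.
Proof. by rewrite DAA (vM Hv) ?expf_neq0 // (vX Hv) // vU mulr0 addr0. Qed.
Let sDAA : Sq4 (DA A) <-> Sq4 D.
Proof. by rewrite DAA Sq4_mulsq. Qed.
Let hDlA : isDelta d (DA A) S.
Proof.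
by have := isDelta_sq Hv (erefl (odd d)) U0 hDl; rewrite vU mulr0 addr0 -DAA.
Qed.

Lemma qf_half (x : 'cV[F]_d) : (x^T *m M *m x) 0 0 = qf A x / 2.
Proof.
have e : x^T *m (A *m x) = 2 *: (x^T *m M *m x) by rewrite -scalemxAl -scalemxAr mulmxA.
rewrite /qf e; move: (x^T *m M *m x) => T; rewrite [(2 *: T) 0 0]mxE.
by field; apply: (two_neq0 Hv).
Qed.

(** A weight [k + 1] allows the doubled bound -1, which still rounds up to integrality. *)
Lemma raise_int (k : nat) c cc x : (forall i, (i < d)%N -> (a i <= k.+1)%N) ->
  raise A a k c cc x -> forall i, hv (x i 0) 0.
Proof.
move=> ak [h _ _] i; apply: (@hv_round _ _ _ 0); apply: hvW (h i) _.
by have := ak i (ltn_ord i); lia.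
Qed.

Lemma step1 (k cc : nat) (c : F) x :
  raise A a k c cc x -> (forall i, (i < d)%N -> (a i <= k.+1)%N) ->
  (forall i, (i < d)%N -> (a i <= cc)%N) ->
  isDelta (d + 1) (D2 (block_mx B 0 0 (c%:M : 'M_1))) (S + cc%:Z) ->
  good_basis (block_mx B 0 0 (c%:M : 'M_1)) (aext d a cc) (block_mx U (U *m x) 0 1%:M).
Proof.
move=> hr ak acc hD; have [r1 r2 r3] := hr; apply: step => //.
- by rewrite tr_scalar_mx.
- by move=> i j; rewrite ord1; apply: raise_int hr i.
- by move=> i j; rewrite ord1; apply: r2.
- move=> j; rewrite !ord1 mxE -/M qf_half mxE eqxx mulr1n; exact: r3.
- by move=> i j; rewrite !ord1 eqxx.
- by rewrite mul1n.
Qed.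

(** Both vectors are corrected from the same old lattice and given weight [k + 1], even if a
    correction would allow more. *)
Lemma step2 (k : nat) (c1 c2 : F) cc1 cc2 x1 x2 :
  raise A a k c1 cc1 x1 -> raise A a k c2 cc2 x2 -> k.+1%:Z <= cc1 -> k.+1%:Z <= cc2 ->
  (forall i, (i < d)%N -> (a i <= k.+1)%N) ->
  isDelta (d + 2) (D2 (block_mx B 0 0 (diag2 c1 c2))) (S + (2 * k.+1)%N%:Z) ->
  good_basis (block_mx B 0 0 (diag2 c1 c2)) (aext d a k.+1)
    (block_mx U (U *m (\matrix_(i, j) if j == 0 then x1 i 0 else x2 i 0)) 0 1%:M).
Proof.
move=> h1 h2 k1 k2 ak hD; set w := \matrix_(i, j) _ : 'M_(d, 2).
have I2 (j : 'I_2) : j = 0 \/ j = 1.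
  by case: j => [[|[|//]] ?]; [left|right]; apply: val_inj.
pose X (j : 'I_2) := if j == 0 then x1 else x2.
have wX i j : w i j = X j i 0 by rewrite mxE /X; case: eqP.
have cw j : col j w = X j by apply/matrixP => i l; rewrite mxE wX ord1.
have hX j : [/\ forall i, hv (X j i 0) (k%:Z - (a i)%:Z),
     forall i, hv ((A *m X j) i 0) ((a i)%:Z + k.+1%:Z) &
     hv (diag2 c1 c2 j j + qf A (X j) / 2) (2 * k.+1%:Z)].
  have [r1 r2 r3] := h1; have [s1 s2 s3] := h2.
  case: (I2 j) => ->; rewrite mxE eqxx /X /=; split=> //; try move=> i.
  - by apply: hvW (r2 i) _; lia.
  - by apply: hvW r3 _; lia.
  - by apply: hvW (s2 i) _; lia.
  - by apply: hvW s3 _; lia.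
have wMw i j : (w^T *m M *m w) i j = bf M (X i) (X j).
  rewrite /bf -!cw -[w^T *m M *m w]mulmxA !mxE; apply: eq_bigr => l _.
  rewrite !mxE; congr (_ * _); apply: eq_bigr => t _; by rewrite !mxE.
apply: step => //.
- by apply/matrixP => i j; rewrite !mxE eq_sym; case: eqP => // ->.
- move=> i j; rewrite wX; apply: (@hv_round _ _ _ 0).
  by have [r1 _ _] := hX j; apply: hvW (r1 i) _; have := ak i (ltn_ord i); lia.
- move=> i j; rewrite -/M -/A; have [_ r2 _] := hX j.
  have -> : (A *m w) i j = (A *m X j) i 0.
    by rewrite -cw !mxE; apply: eq_bigr => l _; rewrite !mxE.
  exact: r2.
- move=> j; rewrite mxE -/M wMw; have [_ _ r3] := hX j.
  have -> : bf M (X j) (X j) = qf A (X j) / 2 by rewrite -qf_half /bf mulmxA.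
  exact: r3.
- move=> i j ij; rewrite mxE -/M wMw mxE (negPf ij) add0r.
  have -> : 2 * bf M (X i) (X j) = bf A (X i) (X j).
    by rewrite /bf /A -scalemxAl -scalemxAr [RHS]mxE.
  (* The corrections are the only source of the cross term; its doubled bound [2 k + 1] rounds up to
     [2 k + 2]. *)
  apply: hv_round; rewrite bfE; apply: hv_sum => // l _.
  have [r1 _ _] := hX i; have [_ r2 _] := hX j.
  by apply: hvW (hvM Hv (r1 l) (r2 l)) _; lia.
Qed.

(** The discriminant of the block is a square modulo 4 of order [2 k], so Delta grows by [2 k] and
    no correction is required. *)
Lemma stepE (k : nat) (C : 'M[F]_2) :
  C^T = C -> (forall i, (i < d)%N -> (a i <= k)%N) ->
  (forall j, hv (C j j) (2 * k%:Z)) -> (forall i j, hv (2 * C i j) (2 * k%:Z)) ->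
  D2 C != 0 -> v (D2 C) = 2 * k%:Z -> Sq4 (D2 C) ->
  good_basis (block_mx B 0 0 C) (aext d a k) (block_mx U (U *m 0) 0 1%:M).
Proof.
move=> sC ak hCd hCo C0 vC sC4; apply: step => //.
- by move=> i j; rewrite mxE; left.
- by move=> i j; rewrite mulmx0 mxE; left.
- by move=> j; rewrite mulmx0 addr0.
- by move=> i j _; rewrite mulmx0 addr0.
rewrite -/(D2 _) D2_block2 -/D -/S.
have od : odd (d + 2) = odd d by lia.
have DC0 : D * D2 C != 0 := mulf_neq0 D0 C0.
have vDC : v (D * D2 C) = v D + 2 * k%:Z by rewrite (vM Hv D0 C0) vC.
move: hDl; rewrite /isDelta od DC0 vDC.
case: (odd d) => -[_ h]; split=> //; first by lia.
case: h => [[h1 h2]|[h1 [t h2] h3]|[[t h1] h2]].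
- by apply: Or31; split; [apply: Sq4M|lia].
- apply: Or32; split; [by rewrite Sq4_mul|exists (t + k%:Z); lia|lia].
- by apply: Or33; split; [exists (t + k%:Z); lia|lia].
Qed.

Lemma raise_open (k : nat) : (odd d -> odz (v D - k%:Z)) -> (~~ odd d -> ~ Sq4 D) ->
  forall c1, hv c1 (2 * k%:Z) -> exists x, raise A a k c1 (k.+1) x.
Proof.
move=> h1 h2 c1 hc1.
have [c2 o] : exists c2, open_vec A (fun i : 'I_d => (a i)%:Z) k 1 c2.
  have [od|od] := boolP (odd d).
    have [c2 [o _]] : exists c, open_vec A (fun i : 'I_d => (a i)%:Z) k 2 c /\
      exists2 P, P != 0 & hv (DA A - qf A c * P ^+ 2) (2 * v (DA A) + 4).
      by apply: open_odd => //; rewrite vDAA; apply: h1.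
    by exists c2; apply: open_vec_le o.
  have [] // := open_even Hv k%:Z hA od hDlA.
  by rewrite sDAA; apply: h2.
have -> : k.+1%:Z = k%:Z + 1 by lia.
exact: (raise1 Hv hc1 o).
Qed.

Section AddOne.
Variables (k : nat) (c : F).
Hypotheses (c0 : c != 0) (vc : v c = k).
Let D' := D2 (block_mx B 0 0 (c%:M : 'M_1)).

Let hc : hv c (2 * k%:Z). Proof. by right; rewrite vc. Qed.

Let D'0v : D' != 0 /\ v D' = v D + k%:Z + 1.
Proof.
have t0 := two_neq0 Hv.
have e : D * (2 * c) != 0 /\ v (D * (2 * c)) = v D + k%:Z + 1.
  have c20 : 2 * c != 0 := mulf_neq0 t0 c0.
  split; first exact: mulf_neq0 D0 c20.
  by rewrite (vM Hv D0 c20) (vM Hv t0 c0) vc (u2_two Hv); lia.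
rewrite /D' D2_block1 -/D; case: (odd d); last by rewrite mul1r.
by rewrite mulN1r oppr_eq0 (vN Hv).
Qed.

(* [delta0]: the new vector keeps weight [k]; [delta2]: it reaches [k+2]; otherwise [k+1] *)
Definition delta0 := (~~ odd d /\ Sq4 D) \/ (odd d /\ odz (v D')).
Definition delta2 := (odd d /\ Sq4 D') \/ (~~ odd d /\ odz (v D)).

Let od1 : odd (d + 1) = ~~ odd d. Proof. by rewrite addn1. Qed.

(** The order of [D] grows by [k + 1] while the parity of the rank changes: comparing the two
    branches of [isDelta] leaves the increase [k]. *)
Lemma delta0_Delta : delta0 -> isDelta (d + 1) D' (S + k%:Z).
Proof.
have [D'0 vD'] := D'0v; move=> h; split=> //; rewrite od1.
move: hDl => -[_]; case: h => [[od s]|[od s]]; rewrite ?od ?(negPf od) /=.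
  case=> [[_ h]|[//]|[h _]]; first by lia.
  by case: (evz_odzF (Sq4_evz Hv D0 s) h).
by move=> h; apply: Or33; split=> //; lia.
Qed.

Lemma raise_half : ~ delta0 -> forall c1, hv c1 (2 * k%:Z) -> exists x, raise A a k c1 (k.+1) x.
Proof.
have [D'0 vD'] := D'0v => nd; apply: raise_open.
  move=> od; case: (evz_or_odz (v D')) => [[t e]|e]; last by case: nd; right.
  by exists (t - k%:Z - 1); lia.
by move=> od s; apply: nd; left.
Qed.

Lemma delta1_Delta : ~ delta0 -> ~ delta2 -> isDelta (d + 1) D' (S + k.+1%:Z).
Proof.
have [D'0 vD'] := D'0v => n0 n2; split=> //; rewrite od1.
move: hDl => -[_]; have [od|od] := boolP (odd d) => /=.
  move=> h; apply: Or32; split; [|by case: (evz_or_odz (v D')) => // e; case: n0; right|lia].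
  by move=> s; apply: n2; left.
case=> [[s _]|[_ _ h]|[s _]]; [by case: n0; left|lia|by case: n2; right].
Qed.

Lemma delta2_Delta : delta2 -> isDelta (d + 1) D' (S + k.+2%:Z).
Proof.
have [D'0 vD'] := D'0v => h; split=> //; rewrite od1.
move: hDl => -[_]; case: h => [[od s]|[od s]]; rewrite ?od ?(negPf od) /=.
  by move=> h; apply: Or31; split=> //; lia.
case=> [[s' _]|[_ e _]|[_ e]]; last by lia.
  by case: (evz_odzF (Sq4_evz Hv D0 s') s).
by case: (evz_odzF e s).
Qed.

Lemma delta2_N0 : delta2 -> ~ delta0.
Proof.
have [D'0 vD'] := D'0v; case=> [[od s]|[od s]] [[od' s']|[od' s']].
- by rewrite od in od'.
- exact: evz_odzF (Sq4_evz Hv D'0 s) s'.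
- exact: evz_odzF (Sq4_evz Hv D0 s') s.
- by rewrite od' in od.
Qed.

(** In odd rank one open vector suffices, because [D'] is a square modulo 4; in even rank the odd
    order of [D] provides open vectors of levels [k] and [k + 1]. *)
Lemma raise_full : delta2 -> exists x, raise A a k c (k.+2) x.
Proof.
have [D'0 vD'] := D'0v => d2.
have -> : k.+2%:Z = k%:Z + 2 by lia.
case: d2 => [[od s]|[od s]].
  have [c2 [o [P P0 hP]]] : exists c, open_vec A (fun i : 'I_d => (a i)%:Z) k 2 c /\
      exists2 P, P != 0 & hv (DA A - qf A c * P ^+ 2) (2 * v (DA A) + 4).
    apply: open_odd => //; rewrite vDAA.
    have [t e] := Sq4_evz Hv D'0 s.
    by exists (t - k%:Z - 1); lia.
  apply: (@raise2_one _ _ Hv _ _ a k c c2) => //.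
  have [q0 vq] := open_vec_half Hv o; set q := qf A c2 / 2 in q0 vq *.
  have eq : qf A c2 = 2 * q by rewrite /q; field; apply: (two_neq0 Hv).
  have t0 := two_neq0 Hv.
  have DA0 : DA A != 0 by rewrite DAA mulf_neq0 ?expf_neq0.
  have N0 : - c * q != 0 by rewrite mulf_neq0 ?oppr_eq0.
  (* [D' * \det U ^+ 2] is [- 2 c] times [DA A], and [DA A] is close to [2 q P^2]; so [T] is a
     square modulo 4, and hence [- c * q] too. *)
  pose T := - c * q * (2 * P) ^+ 2.
  have : Sq4 T.
    have s1 : Sq4 (D' * \det U ^+ 2) by apply/Sq4_mulsq.
    have W0 : D' * \det U ^+ 2 != 0 by rewrite mulf_neq0 ?expf_neq0.
    have e1 : D' * \det U ^+ 2 = - (2 * c) * DA A.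
      by rewrite /D' D2_block1 od DAA -/D; ring.
    have vW : v (D' * \det U ^+ 2) = v (DA A) + v (2 * c).
      have n0 : - (2 * c) != 0 by rewrite oppr_eq0; apply: mulf_neq0.
      by rewrite e1 (vM Hv n0 DA0) (vN Hv) addrC.
    have h1 : hv (D' * \det U ^+ 2 - T) (2 * v (D' * \det U ^+ 2) + 4).
      have -> : D' * \det U ^+ 2 - T = - (2 * c) * (DA A - qf A c2 * P ^+ 2).
        by rewrite e1 /T eq; ring.
      have -> : 2 * v (D' * \det U ^+ 2) + 4 = 2 * v (- (2 * c)) + (2 * v (DA A) + 4).
        by rewrite vW (vN Hv); ring.
      exact: hvM (hvv v (- (2 * c))) hP.
    exact: Sq4_close h1.
  by rewrite /T Sq4_mulsq // mulf_neq0.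
have ns : ~ Sq4 (DA A) by rewrite sDAA => s'; case: (evz_odzF (Sq4_evz Hv D0 s') s).
have s' : odz (v (DA A)) by rewrite vDAA.
have [_ /(_ s') [c1 o1]] := open_even Hv k%:Z hA od hDlA ns.
have [_ /(_ s') [c2 o2]] := open_even Hv (k%:Z + 1) hA od hDlA ns.
exact: (raise2_two Hv sA hc o1 o2).
Qed.

End AddOne.

(** The order of [D] grows by [2 k + 2]; the hypothesis ensures that both discriminants fall under
    the same clause of [isDelta]. *)
Lemma two_Delta (k : nat) (c1 c2 : F) :
  c1 != 0 -> v c1 = k -> c2 != 0 -> v c2 = k ->
  let D'' := D2 (block_mx B 0 0 (diag2 c1 c2)) in
  [\/ odd d, odz (v D) | ~ Sq4 D /\ ~ Sq4 D''] ->
  isDelta (d + 2) D'' (S + (2 * k.+1)%N%:Z).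
Proof.
move=> c10 vc1 c20 vc2 D'' h.
have t0 := two_neq0 Hv.
have f4 : (4 : F) = 2 * 2 by rewrite -natrM.
have [N0 vN4] : - (4 * (c1 * c2)) != 0 /\ v (- (4 * (c1 * c2))) = 2 * k%:Z + 2.
  rewrite (vN Hv) f4 oppr_eq0 !mulf_neq0 // !(vM Hv) ?mulf_neq0 // vc1 vc2 (u2_two Hv).
  by split=> //; lia.
have eD : D'' = D * - (4 * (c1 * c2)) by rewrite /D'' D2_block2 D2_diag2.
have D''0 : D'' != 0 by rewrite eD mulf_neq0.
have vD'' : v D'' = v D + 2 * k%:Z + 2 by rewrite eD (vM Hv) // vN4; lia.
split=> //; have -> : odd (d + 2) = odd d by lia.
move: hDl => -[_]; have [od|od] := boolP (odd d); first by lia.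
case=> [[s _]|[ns [t e] e']|[[t e] e']].
- case: h => [od'|o|[]//]; first by rewrite od' in od.
  by case: (evz_odzF (Sq4_evz Hv D0 s) o).
- case: h => [od'|o|[_ ns'']]; first by rewrite od' in od.
    by case: (evz_odzF (ex_intro _ t e) o).
  by apply: Or32; split=> //; [exists (t + k%:Z + 1)|]; lia.
- by apply: Or33; split; [exists (t + k%:Z + 1)|]; lia.
Qed.

End OneBasis.
End Blocks.

(** * Pre-optimal forms *)

Section BlockMatrices.
Variable F : fieldType.

Lemma bmat_cat (l1 l2 : seq (blk F)) i j :
  bmat (l1 ++ l2) i j =
  if (i < totdeg l1)%N && (j < totdeg l1)%N then bmat l1 i j
  else if (totdeg l1 <= i)%N && (totdeg l1 <= j)%N
       then bmat l2 (i - totdeg l1) (j - totdeg l1) else 0.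
Proof.
elim: l1 i j => [|b l1 IH] i j /=; first by rewrite /totdeg /= !subn0.
have -> : totdeg (b :: l1) = (blk_deg b + totdeg l1)%N by [].
rewrite IH !subnDA; set d := blk_deg b; set t := totdeg l1.
case: (ltnP i d) => id; case: (ltnP j d) => jd /=.
- have -> : (i < d + t)%N by lia. have -> : (j < d + t)%N by lia.
  by [].
- have -> : (d + t <= i)%N = false by lia.
  by rewrite andFb; case: ifP.
- have -> : (d + t <= j)%N = false by lia.
  by rewrite andbF; case: ifP.
have -> : (i < d + t)%N = (i - d < t)%N by lia.
have -> : (j < d + t)%N = (j - d < t)%N by lia.
have -> : (d + t <= i)%N = (t <= i - d)%N by lia.
have -> : (d + t <= j)%N = (t <= j - d)%N by lia.
by [].
Qed.

Definition bdef : blk F := BDiag 0 [::].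

Variable bs : seq (blk F).
Local Notation f := (bmat bs).
Definition pdeg i := totdeg (take i bs).
Local Notation dd := pdeg.
Definition pgram i : 'M[F]_(dd i) := mxn (dd i) f.
Local Notation Bi := pgram.

Lemma bmat_take i k l : (k < dd i)%N -> (l < dd i)%N -> bmat (take i bs) k l = f k l.
Proof.
by move=> hk hl; rewrite -[in RHS](cat_take_drop i bs) bmat_cat -/(dd i) hk hl.
Qed.

Lemma Bof_take i : Bof (take i bs) = Bi i.
Proof. by apply/matrixP => k l; rewrite !mxE bmat_take. Qed.

Lemma totdeg_cat (l1 l2 : seq (blk F)) : totdeg (l1 ++ l2) = (totdeg l1 + totdeg l2)%N.
Proof. by rewrite /totdeg map_cat sumn_cat. Qed.

Lemma ddS m : (m < size bs)%N -> dd m.+1 = (dd m + blk_deg (nth bdef bs m))%N.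
Proof.
move=> hm; rewrite /dd (take_nth bdef hm) -cats1 totdeg_cat.
by rewrite /totdeg /= addn0.
Qed.

Lemma bmat_next m i j : (m < size bs)%N ->
  (i < dd m.+1)%N -> (j < dd m.+1)%N ->
  f i j = if (i < dd m)%N && (j < dd m)%N then f i j
          else if (dd m <= i)%N && (dd m <= j)%N
               then blk_entry (nth bdef bs m) (i - dd m) (j - dd m) else 0.
Proof.
move=> hm; rewrite ddS //.
rewrite -[X in bmat X](cat_take_drop m bs) (drop_nth bdef hm) !bmat_cat -/(dd m).
case: ifP => // _; case: ifP => // /andP [h1 h2] h3 h4 /=.
set d := blk_deg _ in h3 h4 *.
have -> : (i - dd m < d)%N by lia.
by have -> : (j - dd m < d)%N by lia.
Qed.

Lemma mxn_next m : (m < size bs)%N ->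
  mxn (dd m + blk_deg (nth bdef bs m)) f =
  block_mx (Bi m) 0 0 (mxn _ (blk_entry (nth bdef bs m))).
Proof.
move=> hm; have e := ddS hm; apply/matrixP => i j; rewrite mxE (bmat_next hm); last 2 first.
- by rewrite e.
- by rewrite e.
case: (split_ordP i) => i' ->; case: (split_ordP j) => j' -> /=.
- by rewrite block_mxEul mxE ?ltn_ord.
- rewrite block_mxEur mxE; have h := ltn_ord i'.
  by have -> : (dd m <= i')%N = false by lia.
- rewrite block_mxEdl mxE; have h := ltn_ord j'.
  by have -> : (dd m <= j')%N = false by [lia]; rewrite andbF.
- by rewrite block_mxEdr mxE !leq_addr /= !addKn.
Qed.

(** Two blocks of degree 1 are read as one diagonal block of degree 2, for the exceptional pair with
    weights [k+2] and [k]. *)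
Lemma mxn_next2 m k u1 u2 : (m.+1 < size bs)%N ->
  nth bdef bs m = BDiag k [:: u1] -> nth bdef bs m.+1 = BDiag k [:: u2] ->
  mxn (dd m + 2) f = block_mx (Bi m) 0 0 (diag2 (2 ^+ k * u1) (2 ^+ k * u2)).
Proof.
move=> hm e1 e2; have hm' : (m < size bs)%N by lia.
have d1 := ddS hm'; have d2 := ddS hm; rewrite e1 /= in d1; rewrite e2 /= d1 in d2.
have H i j : (i < dd m + 2)%N -> (j < dd m + 2)%N ->
  f i j = if (i < dd m)%N && (j < dd m)%N then f i j else
          if (dd m <= i)%N && (i == j) then
             (if i == dd m then 2 ^+ k * u1 else 2 ^+ k * u2) else 0.
  move=> hi hj; rewrite (bmat_next hm) ?d2; [|lia|lia].
  rewrite d1 e2 /=.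
  case: (ltnP i (dd m + 1)) => i1; case: (ltnP j (dd m + 1)) => j1 /=.
  - rewrite (bmat_next hm') ?d1; [|lia|lia]; rewrite e1 /=.
    case: ifP => // n1; have -> : (dd m <= i)%N && (dd m <= j)%N = (dd m <= i)%N && (i == j).
      by lia.
    case: ifP => // /andP [h1 /eqP h2]; have -> : i = dd m by lia.
    by rewrite eqxx -h2; have -> : i = dd m by [lia]; rewrite subnn.
  - have -> : (j < dd m)%N = false by lia.
    by rewrite andbF /=; have -> : (i == j) = false by [lia]; rewrite andbF.
  - have -> : (i < dd m)%N = false by lia.
    by rewrite /=; have -> : (i == j) = false by [lia]; rewrite andbF.
  - have -> : i = (dd m + 1)%N by lia. have -> : j = (dd m + 1)%N by lia.
    rewrite subnn !eqxx /=; have -> : (dd m + 1 < dd m)%N = false by lia.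
    have -> : (dd m <= dd m + 1)%N by lia.
    by have -> : (dd m + 1 == dd m)%N = false by lia.
apply/matrixP => i j; rewrite mxE H ?ltn_ord //.
case: (split_ordP i) => i' ->; case: (split_ordP j) => j' -> /=.
- by rewrite block_mxEul mxE ?ltn_ord.
- rewrite block_mxEur mxE; have h := ltn_ord i'.
  by have -> : (dd m <= i')%N = false by lia.
- rewrite block_mxEdl mxE; have h := ltn_ord j'.
  by have -> : (dd m + i' == j')%N = false by [lia]; rewrite andbF.
- rewrite block_mxEdr mxE leq_addr /= eqn_add2l.
  have -> : (nat_of_ord i' == j') = (i' == j') by [].
  case: ifP => // _; have -> : (dd m + i' == dd m)%N = (i' == 0 :> 'I_2).
    by rewrite -{2}[dd m]addn0 eqn_add2l.
  by [].
Qed.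

End BlockMatrices.

(** * Induction over the blocks of a pre-optimal form *)

Section PreOptimal.
Variables (F : fieldType) (v : F -> int).
Hypothesis Hv : unram2adic v.
Local Notation hv := (hv v).
Local Notation Sq4 := (Sq4 v).
Local Notation isDelta := (isDelta v).
Local Notation good_basis := (good_basis v).
Variable bs : seq (blk F).
Hypothesis Hpo : preoptimal v bs.
Local Notation f := (bmat bs).
Local Notation dd := (pdeg bs).
Local Notation Bi := (pgram bs).
Local Notation nb m := (nth (BDiag 0 [::]) bs m).

Definition Dv i := D2 (Bi i).

Lemma diag_sum2 m : (m < size bs)%N -> blk_isdiag (nb m) -> (blk_deg (nb m) <= 2)%N.
Proof.
move=> hm hd; have [_ [[h _] _]] := Hpo.
apply: leq_trans (h (blk_k (nb m))).
rewrite (big_nth (BDiag 0 [::])) big_mkord (bigD1 (Ordinal hm)) /= ?hd ?eqxx //.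
exact: leq_addr.
Qed.

Lemma diag_sum_pair m m' : (m < m')%N -> (m' < size bs)%N ->
  blk_isdiag (nb m) -> blk_isdiag (nb m') -> blk_k (nb m) = blk_k (nb m') ->
  (blk_deg (nb m) + blk_deg (nb m') <= 2)%N.
Proof.
move=> mm hm' hd hd' hk; have hm : (m < size bs)%N by lia.
have [_ [[h _] _]] := Hpo.
apply: leq_trans (h (blk_k (nb m))).
rewrite (big_nth (BDiag 0 [::])) big_mkord (bigD1 (Ordinal hm)) /= ?hd ?eqxx //.
rewrite leq_add2l (bigD1 (Ordinal hm')) /= ?hd' ?hk ?eqxx //=; first exact: leq_addr.
by rewrite -(inj_eq val_inj) /=; lia.
Qed.

Lemma blk_cases m : (m < size bs)%N ->
  [\/ exists k u, nb m = BDiag k [:: u] /\ unit_o v u,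
      exists k u1 u2, [/\ nb m = BDiag k [:: u1; u2], unit_o v u1 & unit_o v u2] |
      exists k a b c, nb m = BNon k a b c /\ blk_wf v (BNon k a b c)].
Proof.
move=> hm; have [/(_ m hm) wf _] := Hpo; have := diag_sum2 hm.
move: wf; case: (nb m) => [k us|k a b c] /=; last first.
  by move=> h _; apply: Or33; exists k, a, b, c.
move=> [us0 hu] /(_ isT); case: us us0 hu => [//|u1 [|u2 [|//]]] _ hu _.
  by apply: Or31; exists k, u1; split=> //; apply: hu; rewrite inE.
by apply: Or32; exists k, u1, u2; split=> //; apply: hu; rewrite !inE eqxx ?orbT.
Qed.

Lemma v_unit k u : unit_o v u -> 2 ^+ k * u != 0 /\ v (2 ^+ k * u) = k.
Proof.
move=> [u0 vu]; have p0 := pow2_neq0 Hv k.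
by rewrite mulf_neq0 // (vM Hv) // (v_pow2 Hv) vu addr0.
Qed.

Definition Cnon k a b c : 'M[F]_2 := mxn 2 (blk_entry (BNon k a b c)).

Lemma Cnon_facts k a b c : blk_wf v (BNon k a b c) ->
  let C := Cnon k a b c in
  [/\ C^T = C /\ (forall j, hv (C j j) (2 * k%:Z)),
      forall i j, hv (2 * C i j) (2 * k%:Z),
      D2 C != 0, v (D2 C) = 2 * k%:Z & Sq4 (D2 C)].
Proof.
move=> /= [/hv_o ha [/hv_o hb [/hv_o hc [n0 vn]]]].
set C := Cnon k a b c.
have p0 := pow2_neq0 Hv k; have t0 := two_neq0 Hv.
have f4 : (4 : F) = 2 * 2 by rewrite -natrM.
have hp : hv (2 ^+ k) (2 * k%:Z) by right; rewrite (v_pow2 Hv).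
have h2 : hv 2 2 by right; rewrite (u2_two Hv).
have I2 (j : 'I_2) : j = 0 \/ j = 1.
  by case: j => [[|[|//]] ?]; [left|right]; apply: val_inj.
have C00 : C 0 0 = 2 ^+ k * a by rewrite mxE.
have C11 : C 1 1 = 2 ^+ k * c by rewrite mxE.
have C01 : C 0 1 = 2 ^+ k * (b / 2) by rewrite mxE.
have C10 : C 1 0 = 2 ^+ k * (b / 2) by rewrite mxE.
have eD : D2 C = (2 ^+ k) ^+ 2 * - (4 * a * c - b ^+ 2).
  have e i j : (2 *: C) i j = 2 * C i j by rewrite mxE.
  rewrite /D2 /DA det2 !e C00 C11 C01 C10 /= expr1 f4; field; exact: t0.
have hd j : hv (C j j) (2 * k%:Z).
  by case: (I2 j) => ->; rewrite ?C00 ?C11 -[2 * _]addr0; apply: hvM.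
have vD : D2 C != 0 /\ v (D2 C) = 2 * k%:Z.
  have m0 : - (4 * a * c - b ^+ 2) != 0 by rewrite oppr_eq0.
  have q0 := expf_neq0 2 p0.
  split; first by rewrite eD; apply: mulf_neq0.
  by rewrite eD (vM Hv q0 m0) (vN Hv) vn (vX Hv 2 p0) (v_pow2 Hv) addr0.
split; [split=> //|move=> i j|by case: vD|by case: vD|].
- apply/matrixP => i j; rewrite mxE; case: (I2 i) => ->; case: (I2 j) => -> //.
    by rewrite C01 C10.
  by rewrite C01 C10.
- have [ij|ij] := eqVneq i j; first by rewrite ij; apply: hvW (hvM Hv h2 (hd j)) _; lia.
  have -> : 2 * C i j = 2 ^+ k * b.
    move: ij; case: (I2 i) => ->; case: (I2 j) => -> // _; rewrite ?C01 ?C10;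
    by field; exact: t0.
  by rewrite -[2 * k%:Z]addr0; apply: hvM.
- exists (2 ^+ k * b); case: vD => _ ->.
  have -> : D2 C - (2 ^+ k * b) ^+ 2 = - (2 * 2 * (2 ^+ k * 2 ^+ k * (a * c))).
    by rewrite eD f4; ring.
  apply: hvN => //; apply: hvW (hvM Hv (hvM Hv h2 h2) (hvM Hv (hvM Hv hp hp) (hvM Hv ha hc))) _.
  lia.
Qed.

Lemma mxn_diag1 k (u : F) : mxn 1 (blk_entry (BDiag k [:: u])) = (2 ^+ k * u)%:M.
Proof. by apply/matrixP => i j; rewrite !ord1 !mxE. Qed.

Lemma mxn_diag2 k (u1 u2 : F) :
  mxn 2 (blk_entry (BDiag k [:: u1; u2])) = diag2 (2 ^+ k * u1) (2 ^+ k * u2).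
Proof.
by apply/matrixP => i j; rewrite !mxE; case: i => [[|[|//]] ?]; case: j => [[|[|//]] ?].
Qed.

Lemma next_diag1 m k u : (m < size bs)%N -> nb m = BDiag k [:: u] ->
  dd m.+1 = (dd m + 1)%N /\
  mxn (dd m + 1) f = block_mx (Bi m) 0 0 ((2 ^+ k * u)%:M : 'M_1).
Proof.
move=> hm e; have := ddS hm; have := mxn_next hm; rewrite /bdef e /= => h1 h2.
by split=> //; rewrite h1 mxn_diag1.
Qed.

Lemma next_diag2 m k u1 u2 : (m < size bs)%N -> nb m = BDiag k [:: u1; u2] ->
  dd m.+1 = (dd m + 2)%N /\
  mxn (dd m + 2) f = block_mx (Bi m) 0 0 (diag2 (2 ^+ k * u1) (2 ^+ k * u2)).
Proof.
move=> hm e; have := ddS hm; have := mxn_next hm; rewrite /bdef e /= => h1 h2.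
by split=> //; rewrite h1 mxn_diag2.
Qed.

Lemma next_non m k a b c : (m < size bs)%N -> nb m = BNon k a b c ->
  dd m.+1 = (dd m + 2)%N /\
  mxn (dd m + 2) f = block_mx (Bi m) 0 0 (Cnon k a b c).
Proof.
by move=> hm e; have := ddS hm; have := mxn_next hm; rewrite /bdef e /= => h1 h2.
Qed.

Lemma Dv_mxn m n : dd m = n -> Dv m = D2 (mxn n f).
Proof. by move=> <-. Qed.

Lemma Dv_v1 m k u : (m < size bs)%N -> nb m = BDiag k [:: u] -> unit_o v u ->
  Dv m != 0 -> Dv m.+1 != 0 /\ v (Dv m.+1) = v (Dv m) + k%:Z + 1.
Proof.
move=> hm e hu D0; have [e1 e2] := next_diag1 hm e.
have [c0 vc] := v_unit k hu; have t0 := two_neq0 Hv.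
have c20 := mulf_neq0 t0 c0.
have [n0 vn] : Dv m * (2 * (2 ^+ k * u)) != 0 /\
   v (Dv m * (2 * (2 ^+ k * u))) = v (Dv m) + k%:Z + 1.
  split; first exact: mulf_neq0.
  by rewrite (vM Hv D0 c20) (vM Hv t0 c0) vc (u2_two Hv); lia.
rewrite (Dv_mxn e1) e2 D2_block1 -/(Dv m); case: (odd _); last by rewrite mul1r.
by rewrite mulN1r oppr_eq0 (vN Hv).
Qed.

Lemma Dv0 : Dv 0 = 1.
Proof.
have e : dd 0 = 0%N by rewrite /pdeg take0.
by rewrite (Dv_mxn e) /D2 /DA det_mx00 mulr1.
Qed.

Lemma Dv_neq0 m : (m <= size bs)%N -> Dv m != 0.
Proof.
elim: m => [|m IH] hm; first by rewrite Dv0 oner_neq0.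
have D0 := IH (ltnW hm).
case: (blk_cases hm) => [[k [u [e hu]]]|[k [u1 [u2 [e hu1 hu2]]]]|[k [a [b [c [e wf]]]]]].
- by case: (Dv_v1 hm e hu D0).
- have [e1 e2] := next_diag2 hm e; rewrite (Dv_mxn e1) e2 D2_block2 D2_diag2 -/(Dv m).
  have [c1 _] := v_unit k hu1; have [c2 _] := v_unit k hu2; have t0 := two_neq0 Hv.
  apply: mulf_neq0 => //; rewrite oppr_eq0.
  have -> : (4 : F) = 2 * 2 by rewrite -natrM.
  by apply: mulf_neq0; apply: mulf_neq0.
- have [e1 e2] := next_non hm e; rewrite (Dv_mxn e1) e2 D2_block2 -/(Dv m).
  by have [_ _ C0 _ _] := Cnon_facts wf; apply: mulf_neq0.
Qed.

Lemma DB_Dv m : ~~ odd (dd m) -> DB (Bof (take m bs)) = Dv m.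
Proof.
move=> ev; rewrite Bof_take /DB /Dv /D2 /DA detZ -/(dd m).
have -> : (2 : F) ^+ (dd m) = 4 ^+ (dd m)./2.
  have -> : (4 : F) = 2 ^+ 2 by rewrite -natrX.
  by rewrite -exprM; congr (_ ^+ _); lia.
by rewrite -[(-4)]mulN1r exprMn mulrA.
Qed.

Lemma v_Dv m : (m <= size bs)%N ->
  v (Dv m) = v (\det (Bof (take m bs))) + (dd m)%:Z.
Proof.
move=> hm; have D0 := Dv_neq0 hm; move: D0.
rewrite Bof_take /Dv /D2 /DA detZ => D0.
have d0 : \det (Bi m) != 0.
  by apply: contraNneq D0 => ->; rewrite !mulr0.
have n0 : (-1 : F) ^+ (dd m)./2 != 0 by rewrite expf_neq0 // oppr_eq0 oner_neq0.
have p0 := pow2_neq0 Hv (dd m).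
rewrite (vM Hv n0 (mulf_neq0 p0 d0)) (vM Hv p0 d0) (v_pow2 Hv) (vX Hv) ?oppr_eq0 ?oner_neq0 //.
by rewrite (vN Hv) (v1 Hv) mulr0 add0r addrC.
Qed.

(** [raise_none] and [raise_two] are [delta0] and [delta2] for the next vector, in terms of the
    invariants in (PO3)-(PO6). *)
Definition raise_none m := (~~ odd (dd m) /\ Sq4 (Dv m)) \/ (odd (dd m) /\ odz (v (Dv m.+1))).
Definition raise_two m := (odd (dd m) /\ Sq4 (Dv m.+1)) \/ (~~ odd (dd m) /\ odz (v (Dv m))).

(** All weights are bounded through the last block only, which suffices as the conditions on
    neighbouring blocks decide whether the next weight is large enough. *)
Definition last_bound m n (a : nat -> nat) : Prop :=
  if m is m'.+1 then
    match nb m' with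
    | BNon k _ _ _ => forall j, (j < n)%N -> (a j <= k)%N
    | BDiag k us => forall j, (j < n)%N ->
        (a j <= k.+2)%N /\ (size us = 2%N \/ ~ raise_two m' -> (a j <= k.+1)%N)
    end
  else True.

(** After a diagonal block (PO2) gives [k' <= k - 1]; if [k' = k - 1], (PO5) excludes [raise_two],
    and with it the weight [k' + 2]. *)
Lemma pre_non m k x y z a : (m < size bs)%N -> nb m = BNon k x y z -> last_bound m (dd m) a ->
  forall j, (j < dd m)%N -> (a j <= k)%N.
Proof.
case: m => [|m] hm e; first by rewrite /pdeg take0.
have hm' : (m < size bs)%N by lia.
have [_ [_ [po2 [_ [_ [po5 _]]]]]] := Hpo.
have := po2 m.+1 m.+2 isT (leqnn _) hm; rewrite /= e /=.
have := po5 m.+1 isT hm; rewrite /= e /=.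
case: (blk_cases hm') => [[k' [u [e' hu]]]|[k' [u1 [u2 [e' hu1 hu2]]]]|[k' [? [? [? [e' _]]]]]];
  rewrite e' /=; last first.
- by move=> _ [_ h _ _] B j jd; have := h isT isT; have := B j jd; lia.
- move=> h5 [_ _ h _] B j jd; have [h1 h2] := h isT isT.
  have [b1 b2] := B j jd.
  have := b2 (or_introl erefl); lia.
move=> h5 [_ _ h _] B j jd; have [h1 h2] := h isT isT.
have [b1 b2] := B j jd.
have [k1|k1] := eqVneq (k' + 1)%N k; last by lia.
have [_ h6] := h5 isT isT k1.
suff nd : ~ raise_two m by have := b2 (or_intror nd); lia.
have [ed _] := next_diag1 hm' e'.
have od : odd (dd m.+1) = ~~ odd (dd m) by rewrite ed addn1.
have vD := v_Dv hm'.
case: h6 => [[ev /odd_absz [t ot]]|[o nx]].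
  case=> [[o' s]|[ev' _]].
    have /(Sq4_evz Hv (Dv_neq0 hm')) [t' et'] := s.
    move: ev; rewrite -/(dd m.+1) => ev.
    have [g eg] : exists g, dd m.+1 = (2 * g)%N by exists (dd m.+1)./2; lia.
    by move: vD et' ot; rewrite eg; set x1 := v _; set x2 := v _; lia.
  by move: ev; rewrite -/(dd m.+1) od ev'.
case=> [[o' s]|[ev' oz]]; first by move: o; rewrite -/(dd m.+1) od o'.
have [m0|m0] := posnP m.
  by move: oz; rewrite m0 Dv0 (v1 Hv) => -[t]; lia.
apply: (nx m0); rewrite DB_Dv //; apply: NSq4_xi0 => //; first by apply: Dv_neq0; lia.
by move=> s; case: (evz_odzF (Sq4_evz Hv (Dv_neq0 (ltnW hm')) s) oz).
Qed.

(** Two vectors of equal [k] change the order of the discriminant by [2 k + 2], preserving its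
    parity: the weight [k+2] of the first goes with the weight [k] of the second. *)
Lemma raise_two_raise_none m k u u' : (m.+1 < size bs)%N ->
  nb m = BDiag k [:: u] -> nb m.+1 = BDiag k [:: u'] -> unit_o v u -> unit_o v u' ->
  raise_two m <-> raise_none m.+1.
Proof.
move=> hm e e' hu hu'; have hm' : (m < size bs)%N by lia.
have [ed _] := next_diag1 hm' e.
have od : odd (dd m.+1) = ~~ odd (dd m) by rewrite ed addn1.
have [D1 v1'] := Dv_v1 hm' e hu (Dv_neq0 (ltnW hm')).
have [D2 v2'] := Dv_v1 hm e' hu' D1.
rewrite /raise_two /raise_none od negbK; split=> -[[h1 h2]|[h1 h2]].
- by left.
- by right; split=> //; case: h2 => t ht; exists (t + k%:Z + 1); lia.
- by left.
- by right; split=> //; case: h2 => t ht; exists (t - k%:Z - 1); lia.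
Qed.

(** By (PO1) a preceding diagonal block has smaller [k], so even its weight [k' + 2] is harmless; a
    non-diagonal one has [k' <= k + 1] by (PO2). *)
Lemma pre_diag2 m k u1 u2 a : (m < size bs)%N -> nb m = BDiag k [:: u1; u2] ->
  last_bound m (dd m) a -> forall j, (j < dd m)%N -> (a j <= k.+1)%N.
Proof.
case: m => [|m] hm e; first by rewrite /pdeg take0.
have hm' : (m < size bs)%N by lia.
have [_ [_ [po2 _]]] := Hpo.
have := po2 m.+1 m.+2 isT (leqnn _) hm; rewrite /= e /=.
have := diag_sum_pair (leqnn m.+1) hm; rewrite e.
case: (blk_cases hm') => [[k' [u [e' hu]]]|[k' [v1' [v2' [e' _ _]]]]|[k' [? [? [? [e' _]]]]]];
  rewrite e' /=; last first.
- by move=> _ [_ _ _ /(_ isT isT) h] B j jd; have := B j jd; lia.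
- move=> dp [/(_ isT isT) h _ _ _] B j jd; have [b1 b2] := B j jd.
  have [ek|nk] := eqVneq k' k; last by lia.
  by have := dp isT isT ek.
- move=> dp [/(_ isT isT) h _ _ _] B j jd; have [b1 b2] := B j jd.
  have [ek|nk] := eqVneq k' k; last by lia.
  by have := dp isT isT ek.
Qed.

Lemma pre_diag1 m k u a : (m < size bs)%N -> nb m = BDiag k [:: u] -> unit_o v u ->
  last_bound m (dd m) a -> ~ raise_none m -> forall j, (j < dd m)%N -> (a j <= k.+1)%N.
Proof.
case: m => [|m] hm e hu; first by rewrite /pdeg take0.
have hm' : (m < size bs)%N by lia.
have [_ [_ [po2 _]]] := Hpo.
have := po2 m.+1 m.+2 isT (leqnn _) hm; rewrite /= e /=.
have := diag_sum_pair (leqnn m.+1) hm; rewrite e.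
case: (blk_cases hm') => [[k' [u' [e' hu']]]|[k' [v1' [v2' [e' _ _]]]]|[k' [? [? [? [e' _]]]]]];
  rewrite e' /=; last first.
- by move=> _ [_ _ _ /(_ isT isT) h] B _ j jd; have := B j jd; lia.
- move=> dp [/(_ isT isT) h _ _ _] B _ j jd; have [b1 b2] := B j jd.
  have [ek|nk] := eqVneq k' k; last by lia.
  by have := dp isT isT ek.
- move=> dp [/(_ isT isT) h _ _ _] B n0 j jd; have [b1 b2] := B j jd.
  have [ek|nk] := eqVneq k' k; last by lia.
  rewrite ek in e' b2; apply: b2; right => d2; apply: n0.
  by apply/(raise_two_raise_none hm e' e hu' hu).
Qed.

(** The weight [k] is endangered by a non-diagonal block with [k' = k + 1], excluded by (PO4), and
    by a vector with [k' = k - 1] raised to [k' + 2], excluded by (PO6) or by parity. The last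
    hypothesis sets the exceptional pair aside. *)
Lemma pre_diag0 m k u a : (m < size bs)%N -> nb m = BDiag k [:: u] -> unit_o v u ->
  last_bound m (dd m) a -> raise_none m ->
  (forall m', m = m'.+1 -> ~ exists u', nb m' = BDiag k [:: u'] /\ unit_o v u') ->
  forall j, (j < dd m)%N -> (a j <= k)%N.
Proof.
case: m => [|m] hm e hu; first by rewrite /pdeg take0.
have hm' : (m < size bs)%N by lia.
have [_ [_ [po2 [_ [po4 [_ po6]]]]]] := Hpo.
have D0 := Dv_neq0 (ltnW hm'); have D1 := Dv_neq0 hm'; have D2 := Dv_neq0 hm.
have vD2 := v_Dv hm.
have [edd _] := next_diag1 hm e.
have odd2 : odd (dd m.+2) = ~~ odd (dd m.+1) by rewrite edd addn1.
have := po4 m.+2 isT hm; have := po6 m.+1 isT hm.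
have := po2 m.+1 m.+2 isT (leqnn _) hm; rewrite /= e /=.
have := diag_sum_pair (leqnn m.+1) hm; rewrite e.
case: (blk_cases hm') => [[k' [u' [e' hu']]]|[k' [v1' [v2' [e' _ _]]]]|[k' [? [? [? [e' _]]]]]];
  rewrite e' /=; last first.
- move=> _ [_ _ _ /(_ isT isT) h] _ h4 B d0 _ j jd; have bj := B j jd.
  have [ek|nk] := eqVneq (k + 1)%N k'; last by lia.
  exfalso; case: (h4 ek isT isT) => [//|[_ [[ev /Nodd_absz [t et]]|[o x0]]]].
    rewrite -/(dd m.+2) odd2 negbK in ev.
    case: d0 => [[ev' _]|[_ [t' et']]]; first by rewrite ev in ev'.
    have [g eg] : exists g, dd m.+2 = (2 * g)%N by exists (dd m.+2)./2; lia.
    by move: vD2 et' et; rewrite eg; set x1 := v _; set x2 := v _; lia.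
  rewrite -/(dd m.+2) odd2 in o.
  case: d0 => [[_ s]|[o' _]]; last by rewrite o' in o.
  by move: x0; rewrite DB_Dv // => /xi0_NSq4; apply.
- move=> dp [/(_ isT isT) h _ _ _] _ _ B _ _ j jd; have [b1 b2] := B j jd.
  have [ek|nk] := eqVneq k' k; first by have := dp isT isT ek.
  by have := b2 (or_introl erefl); lia.
- move=> dp [/(_ isT isT) h _ _ _] h6 _ B d0 ns j jd; have [b1 b2] := B j jd.
  have [ek|nk] := eqVneq k' k.
    by case: (ns m erefl); exists u'; rewrite -ek.
  have [ek|nk'] := eqVneq (k' + 1)%N k; last by lia.
  suff nd : ~ raise_two m by have := b2 (or_intror nd); lia.
  have [ed _] := next_diag1 hm' e'.
  have od : odd (dd m.+1) = ~~ odd (dd m) by rewrite ed addn1.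
  have [_ v1'] := Dv_v1 hm' e' hu' D0.
  have [_ v2'] := Dv_v1 hm e hu D1.
  case=> [[o s]|[ev [t et]]].
    have ev : ~~ odd (dd m.+1) by rewrite od o.
    by move: (h6 ev isT isT (esym ek)); rewrite DB_Dv // => /xi0_NSq4; apply.
  case: d0 => [[ev' _]|[_ [t' et']]]; first by rewrite od ev in ev'.
  by lia.
Qed.

(** The weights [a'] of the prefix are quantified separately: for the exceptional pair they are not
    the restriction of those of the whole lattice. *)
Definition prefix_good m n (U : 'M[F]_n) : Prop :=
  if m is m'.+1 then
    exists a', good_basis (Bi m') a' (mxn (dd m') (ent U)) /\
      forall i j, (dd m' <= i)%N -> (i < n)%N -> (j < dd m')%N -> ent U i j = 0
  else True.

Definition state m n : Prop :=
  exists (U : 'M[F]_n) a, [/\ good_basis (mxn n f) a U, last_bound m n a & prefix_good m U].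

Lemma ent_raise_none d e (X : 'M[F]_d) (Y : 'M_(d, e)) (T : 'M_e) i j :
  (d <= i)%N -> (i < d + e)%N -> (j < d)%N -> ent (block_mx X Y 0 T) i j = 0.
Proof.
move=> di ie jd; have ie' : (i - d < e)%N by lia.
have -> : i = nat_of_ord (rshift d (Ordinal ie')) by rewrite /=; lia.
have -> : j = nat_of_ord (lshift e (Ordinal jd)) by [].
by rewrite entE block_mxEdl mxE.
Qed.

Lemma state_intro m e (C : 'M[F]_e) W (U : 'M_(dd m)) a a2 :
  dd m.+1 = (dd m + e)%N -> mxn (dd m + e) f = block_mx (Bi m) 0 0 C ->
  good_basis (Bi m) a U -> good_basis (block_mx (Bi m) 0 0 C) a2 (block_mx U W 0 1%:M) ->
  last_bound m.+1 (dd m + e) a2 -> state m.+1 (dd m.+1).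
Proof.
move=> -> eB g g2 hb; exists (block_mx U W 0 1%:M), a2; split=> //; first by rewrite eB.
exists a; split; first by rewrite lead_block // mxn_ent.
by move=> i j; apply: ent_raise_none.
Qed.

Lemma aext_le d a c n : (forall i, (i < d)%N -> (a i <= c)%N) -> (c <= n)%N ->
  forall j, (aext d a c j <= n)%N.
Proof. by move=> h cn j; rewrite /aext; case: ltnP => // jd; have := h j jd; lia. Qed.

(** Strong induction, since the exceptional pair is appended to the lattice two blocks back. *)
Lemma state_all m : (m <= size bs)%N -> state m (dd m).
Proof.
elim/ltn_ind: m => -[|m] IH hm.
  have -> : dd 0 = 0%N by rewrite /pdeg take0.
  exists 1%:M, (fun=> 0%N); split=> //; split.
    by split; [case|rewrite det1; split; [apply: oner_neq0|apply: v1]].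
  split; [by apply/matrixP; case|by split; [case|split; case]|].
  move=> p; rewrite leqn0 => /eqP -> _; rewrite big_ord0 /DA det_mx00 mulr1.
  split; first exact: oner_neq0.
  by apply: Or31; rewrite expr0 (v1 Hv); split=> //; rewrite -(expr1n _ 2); apply: Sq4_sqr.
have [U [a [g B _]]] := IH m (ltnSn m) (ltnW hm).
have [_ [_ [_ [po3 _]]]] := Hpo.
have D0 := Dv_neq0 (ltnW hm); have D0' := Dv_neq0 hm.
case: (blk_cases hm) => [[k [u [e hu]]]|[k [u1 [u2 [e hu1 hu2]]]]|[k [x [y [z [e wf]]]]]]; last first.
- have [ed eB] := next_non hm e; have ak := pre_non hm e B.
  have [[c1 c2] c3 c4 c5 c6] := Cnon_facts wf.
  apply: (state_intro ed eB g (stepE Hv g c1 ak c2 c3 c4 c5 c6)).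
  by rewrite /last_bound e => j _; apply: aext_le.
- have [ed eB] := next_diag2 hm e; have ak := pre_diag2 hm e B.
  have [c10 vc1] := v_unit k hu1; have [c20 vc2] := v_unit k hu2.
  have eD := Dv_mxn ed; rewrite eB in eD.
  have od : odd (dd m.+1) = odd (dd m) by rewrite ed addn2 /= negbK.
  have [_ h3] := po3 m.+1 isT hm (ltac:(by rewrite /= e)) (ltac:(by rewrite /= e)).
  rewrite /= e /= -/(dd m.+1) -/(dd m) in h3.
  have hD : [\/ odd (dd m), odz (v (Dv m)) | ~ Sq4 (Dv m) /\ ~ Sq4 (Dv m.+1)].
    case: h3 => [[ev [x1 x2]]|[o _]]; last by apply: Or31.
    have ev' : ~~ odd (dd m) by rewrite -od.
    by apply: Or33; rewrite -!DB_Dv //; split; apply: xi0_NSq4.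
  rewrite eD in hD.
  have dl := two_Delta Hv g c10 vc1 c20 vc2 hD.
  (* In odd degree the orders of [Dv m] and of the determinant differ by an odd number, so the
     parity in (PO3) is that required for an open vector of level [k]. *)
  have r1 : odd (dd m) -> odz (v (Dv m) - k%:Z).
    move=> o; case: h3 => [[ev _]|[_ /Nodd_absz [t et]]]; first by rewrite od o in ev.
    have vD := v_Dv (ltnW hm).
    have [q eq] : exists q, dd m = (2 * q + 1)%N by exists (dd m)./2; lia.
    exists (t + q%:Z - k%:Z); move: vD et eq; set x1 := v (Dv m); set x2 := v (\det _); lia.
  have r2 : ~~ odd (dd m) -> ~ Sq4 (Dv m).
    move=> ev; case: h3 => [[_ [x1 _]]|[o _]]; last by rewrite o in ev.
    by rewrite -DB_Dv //; apply: xi0_NSq4.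
  have hc (c : F) : v c = k -> hv c (2 * k%:Z) by move=> vc; right; rewrite vc.
  have [x1 hx1] := raise_open Hv g r1 r2 (hc _ vc1).
  have [x2 hx2] := raise_open Hv g r1 r2 (hc _ vc2).
  apply: (state_intro ed eB g (step2 Hv g hx1 hx2 (lexx _) (lexx _) ak dl)).
  rewrite /last_bound e => j _.
  by have := aext_le ak (leqnn _) j; split=> [|_] //; lia.
have [ed eB] := next_diag1 hm e.
have [c0 vc] := v_unit k hu.
have eD := Dv_mxn ed; rewrite eB in eD.
have hc : hv (2 ^+ k * u) (2 * k%:Z) by right; rewrite vc.
have e0 : raise_none m = delta0 v (Bi m) (2 ^+ k * u) by rewrite /raise_none eD.
have e2 : raise_two m = delta2 v (Bi m) (2 ^+ k * u) by rewrite /raise_two eD.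
case: (classic (raise_none m)) => [d0|n0]; last first.
  have ak := pre_diag1 hm e hu B n0; have n0' := n0; rewrite e0 in n0'.
  case: (classic (raise_two m)) => [d2|n2].
    have d2' := d2; rewrite e2 in d2'.
    have [x hx] := raise_full Hv g c0 vc d2'.
    have ak2 i : (i < dd m)%N -> (a i <= k.+2)%N by move=> /ak; lia.
    apply: (state_intro ed eB g (step1 Hv g hx ak ak2 (delta2_Delta Hv g c0 vc d2'))).
    rewrite /last_bound e => j _; split; first exact: aext_le.
    by case.
  have n2' := n2; rewrite e2 in n2'.
  have [x hx] := raise_half Hv g c0 vc n0' hc.
  apply: (state_intro ed eB g (step1 Hv g hx ak ak (delta1_Delta Hv g c0 vc n0' n2'))).
  rewrite /last_bound e => j _; have := aext_le ak (leqnn _) j; split=> [|_] //; lia.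
(* The new vector stays at weight [k]; this fails to be non-decreasing only after a vector of the
   same [k], which has weight [k+2]. *)
case: (classic (exists m' u', [/\ m = m'.+1, nb m' = BDiag k [:: u'] & unit_o v u'])); last first.
  move=> ns.
  have ak : forall j, (j < dd m)%N -> (a j <= k)%N.
    apply: (pre_diag0 hm e hu B d0) => m' em [u' [e' hu']].
    by apply: ns; exists m', u'.
  have ak1 i : (i < dd m)%N -> (a i <= k.+1)%N by move=> /ak; lia.
  have d0' := d0; rewrite e0 in d0'.
  have hx := raise0 (2 *: (U^T *m Bi m *m U)) a hc.
  apply: (state_intro ed eB g (step1 Hv g hx ak1 ak (delta0_Delta Hv g c0 vc d0'))).
  rewrite /last_bound e => j _; have := aext_le ak (leqnn _) j; split=> [|_] //; lia.
move=> [m' [u' [em e' hu']]].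
subst m; have hm' : (m' < size bs)%N by lia.
have d2 : raise_two m' by apply/(raise_two_raise_none hm e' e hu' hu).
have [V [b [gV BV _]]] := IH m' (leqW (leqnn _)) (ltnW hm').
have [ed' eB'] := next_diag1 hm' e'.
have [c0' vc'] := v_unit k hu'.
have eD' := Dv_mxn ed'; rewrite eB' in eD'.
have e0' : raise_none m' = delta0 v (Bi m') (2 ^+ k * u') by rewrite /raise_none eD'.
have e2' : raise_two m' = delta2 v (Bi m') (2 ^+ k * u') by rewrite /raise_two eD'.
have d2' := d2; rewrite e2' in d2'.
have n0' := delta2_N0 Hv gV c0' vc' d2'.
have n0 : ~ raise_none m' by rewrite e0'.
have ak := pre_diag1 hm' e' hu' BV n0.
have ak2 i : (i < dd m')%N -> (b i <= k.+2)%N by move=> /ak; lia.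
have [x1 hx1] := raise_full Hv gV c0' vc' d2'.
have [x2 hx2] := raise_half Hv gV c0' vc' n0' hc.
have eB2 := mxn_next2 hm e' e.
have ed2 : dd m'.+2 = (dd m' + 2)%N by rewrite ed ed' -addnA.
have hD : [\/ odd (dd m'), odz (v (Dv m')) |
   ~ Sq4 (Dv m') /\ ~ Sq4 (D2 (block_mx (Bi m') 0 0 (diag2 (2 ^+ k * u') (2 ^+ k * u))))].
  by case: d2 => [[o _]|[_ o]]; [apply: Or31|apply: Or32].
have dl := two_Delta Hv gV c0' vc' c0 vc hD.
have k12 : k.+1%:Z <= k.+2%:Z by lia.
have g2 := step2 Hv gV hx1 hx2 k12 (lexx _) ak dl.
(* [g1] uses the same [x1] as [g2], so its basis is the leading part of [W]; alone the first vector
   has weight [k+2], within the pair [k+1]. *)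
have g1 := step1 Hv gV hx1 ak ak2 (delta2_Delta Hv gV c0' vc' d2').
rewrite ed2; set W := block_mx V _ _ _ in g2.
exists W, (aext (dd m') b k.+1); split; first by rewrite eB2.
  rewrite /last_bound e => j _; have := aext_le ak (leqnn _) j; split=> [|_] //; lia.
exists (aext (dd m') b k.+2); rewrite /pgram ed'; split.
  have -> : mxn (dd m' + 1) (ent W) = block_mx V (V *m x1) 0 1%:M.
    apply/matrixP => i j; rewrite mxE.
    case: (split_ordP i) => i' ->; case: (split_ordP j) => j' ->.
    - by rewrite block_mxEul ent_block //= entE.
    - rewrite block_mxEur ord1 /=.
      rewrite -[X in ent W X]/(nat_of_ord (@lshift (dd m') 2 i')).
      rewrite -[(dd m' + 0)%N]/(nat_of_ord (@rshift (dd m') 2 0)) entE block_mxEur.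
      by rewrite !mxE; apply: eq_bigr => l _; rewrite mxE.
    - by rewrite block_mxEdl mxE ent_raise_none //=; have := ltn_ord i'; lia.
    - rewrite block_mxEdr !ord1 /= -[(dd m' + 0)%N]/(nat_of_ord (@rshift (dd m') 2 0)) entE.
      by rewrite block_mxEdr !mxE.
  by rewrite eB'.
move=> i j hi hi2 hj; have [jd|jd] := ltnP j (dd m'); first by rewrite ent_raise_none //; lia.
have -> : i = nat_of_ord (@rshift (dd m') 2 1) by rewrite /=; lia.
have -> : j = nat_of_ord (@rshift (dd m') 2 0) by rewrite /=; lia.
by rewrite entE block_mxEdr mxE.
Qed.

End PreOptimal.

Theorem theorem4p1 (F : fieldType) (v : F -> int) (Hv : unram2adic v)
  (bs : seq (blk F)) (Hr : (0 < size bs)%N)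
  (HB : in_Hn v (Bof bs)) (Hpo : preoptimal v bs) :
  exists u : nat -> nat -> F,
    [/\ in_GLo v (mxn (totdeg bs) u),
        optimal v ((mxn (totdeg bs) u)^T *m Bof bs *m mxn (totdeg bs) u),
        (forall i j, (totdeg (take (size bs).-1 bs) <= i)%N -> (i < totdeg bs)%N ->
                     (j < totdeg (take (size bs).-1 bs))%N -> u i j = 0),
        in_GLo v (mxn (totdeg (take (size bs).-1 bs)) u) &
        optimal v ((mxn (totdeg (take (size bs).-1 bs)) u)^T *m
                   Bof (take (size bs).-1 bs) *m mxn (totdeg (take (size bs).-1 bs)) u)].
Proof.
have [m em] : exists m, size bs = m.+1 by case: (size bs) Hr => // m _; exists m.
have := state_all Hv Hpo (leqnn (size bs)).
rewrite /pdeg take_size em => -[U [a [gU _ [a' [g' z]]]]].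
exists (ent U); rewrite mxn_ent /= Bof_take.
(* [good_GK] identifies the weights of a good basis with the invariant, and these weights already
   lie in [S] of its Gram matrix. *)
have opt n (B V : 'M[F]_n) b : good_basis v B b V -> optimal v (V^T *m B *m V).
  move=> [_ gd]; exists (fun i => b i); split; first exact: good_GK gd.
  by case: gd.
split.
- by case: gU.
- exact: opt gU.
- exact: z.
- by case: g'.
- exact: opt g'.
Qed.
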